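(* Let $\Gamma\subset\mathbf{R}^n$ be a model set modelled on a lattice $\Lambda\subset\mathbf{R}^{m+n}$ and a regular window $W\subset\mathbf{R}^m$. Then $\Gamma$ is an almost periodic pattern. Moreover, for every $\varepsilon>0$ the set $\mathcal{N}_\varepsilon$ of $\varepsilon$-almost-periods of $\Gamma$ contains a relatively dense model set; more precisely, for every $\varepsilon>0$ there exists $R_\varepsilon>0$ such that the set $$\mathcal{N}_\varepsilon^{R_\varepsilon}=\big\{v\in\mathbf{R}^n : \forall R\ge R_\varepsilon,\ D_R^+\big((\Gamma+v)\Delta\Gamma\big)<\varepsilon\big\}$$ contains a relatively dense model set.
   Context: Fix an integer $n\ge 1$. Balls are taken with respect to the sup norm: $B(x,R)=\{y\in\mathbf{R}^n : |x_i-y_i|<R \text{ for all } i\}$, and $B_R=B(0,R)$. $\Delta$ denotes symmetric difference. Model set: let $m\ge 1$, let $\Lambda$ be a lattice of $\mathbf{R}^{m+n}$, let $p_1,p_2$ be the projections of $\mathbf{R}^{m+n}=\mathbf{R}^m\times\mathbf{R}^n$ onto $\mathbf{R}^m\times\{0\}\cong\mathbf{R}^m$ and $\{0\}\times\mathbf{R}^n\cong\mathbf{R}^n$ respectively, and let $W\subset\mathbf{R}^m$ be measurable. The model set modelled on $\Lambda$ and the window $W$ is $\{p_2(\lambda) : \lambda\in\Lambda,\ p_1(\lambda)\in W\}\subset\mathbf{R}^n$. (Neither $p_1$ nor $p_2$ is assumed injective on $\Lambda$.) Regular window: $W\subset\mathbf{R}^m$ is regular if for every affine subspace $V\subset\mathbf{R}^m$,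 $\mathrm{Leb}_V\big(B_V(\partial(V\cap W),\eta)\big)\to 0$ as $\eta\to 0$, where $\mathrm{Leb}_V$ is Lebesgue measure on $V$, the boundary $\partial(V\cap W)$ is taken in $V$, and $B_V(\partial(V\cap W),\eta)$ is the set of points of $V$ at distance smaller than $\eta$ from $\partial(V\cap W)$. Delone set: $\Gamma\subset\mathbf{R}^n$ is relatively dense if there is $R_\Gamma>0$ such that each ball of radius at least $R_\Gamma$ contains at least one point of $\Gamma$; uniformly discrete if there is $r_\Gamma>0$ such that each ball of radius at most $r_\Gamma$ contains at most one point of $\Gamma$; Delone if both. For $R>0$ and $E\subset\mathbf{R}^n$, $D_R^+(E)=\sup_{x\in\mathbf{R}^n}\frac{\mathrm{Card}(E\cap B(x,R))}{\mathrm{Vol}(B_R)}$. For $R'>0$ let $\mathcal{N}_\varepsilon^{R'}=\{v\in\mathbf{R}^n : \forall R\ge R',\ D_R^+((\Gamma+v)\Delta\Gamma)<\varepsilon\}$ and $\mathcal{N}_\varepsilon=\bigcup_{R'>0}\mathcal{N}_\varepsilon^{R'}$. An almost periodic pattern is a Delone set $\Gamma\subset\mathbf{R}^n$ such that for every $\varepsilon>0$ there exists $R_\varepsilon>0$ for which $\mathcal{N}_\varepsilon^{R_\varepsilon}$ is relatively dense.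
   Formalization: That Γ is an almost periodic pattern is proved when Γ is Delone, or when W is bounded and its interior meets p_1(Λ); without this it fails (W empty is regular and gives Γ empty). The claims on almost-periods are proved for every regular window. *)

(* Defs.v *)
From HB Require Import structures.
From mathcomp Require Import all_boot all_order all_algebra.
From mathcomp Require Import all_classical all_reals all_analysis.

Set Implicit Arguments.
Unset Strict Implicit.
Unset Printing Implicit Defensive.
Import Order.TTheory GRing.Theory Num.Theory.
Import numFieldNormedType.Exports.

Local Open Scope classical_set_scope.
Local Open Scope ring_scope.

(* R^d is 'rV[R]_d for R : realType.  Its norm is the sup norm, so ball x r is
   the open cube of centre x and side 2 r. *)

Section LebesgueMeasure.
Context {R : realType} {k : nat}.

Definition box (p : 'rV[R]_k * 'rV[R]_k) : set 'rV[R]_k :=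
  [set x | forall i, p.1 0 i <= x 0 i <= p.2 0 i].

Definition box_volume (p : 'rV[R]_k * 'rV[R]_k) : R :=
  \prod_(i < k) (p.2 0 i - p.1 0 i).

(* Covers are countable *sets* of boxes, rather than sequences, so that the
   empty cover is allowed: in dimension 0 the only box is the point, of volume
   1, and this makes the measure there the counting measure. *)
Definition box_cover (A : set 'rV[R]_k) : set (set ('rV[R]_k * 'rV[R]_k)) :=
  [set D : set ('rV[R]_k * 'rV[R]_k) | [/\ countable D,
               (forall p, D p -> forall i, p.1 0 i <= p.2 0 i) &
               A `<=` \bigcup_(p in D) box p]].

(* The library has no Lebesgue measure on R^k for k > 1.  This is the Lebesgue
   outer measure, which is the Lebesgue measure on measurable sets. *)
Definition lebesgue (A : set 'rV[R]_k) : \bar R :=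
  ereal_inf [set \esum_(p in D) (box_volume p)%:E | D in box_cover A].

Definition lebesgue_measurable (A : set 'rV[R]_k) : Prop :=
  lebesgue.-caratheodory A.

End LebesgueMeasure.

Section RegularWindow.
Context {R : realType} {m : nat}.

(* The affine subspaces of R^m are the ranges of the maps frame a U where the
   rows of U : 'M_(k, m) are orthonormal (this forces k <= m).  Such a map is a
   Euclidean isometry from R^k onto the subspace. *)
Definition frame k (a : 'rV[R]_m) (U : 'M[R]_(k, m)) (t : 'rV[R]_k) :
  'rV[R]_m := a + t *m U.

Definition affine_subspace k (a : 'rV[R]_m) (U : 'M[R]_(k, m)) :
  set 'rV[R]_m := range (frame a U).

Definition lebesgue_on k (a : 'rV[R]_m) (U : 'M[R]_(k, m))
  (A : set 'rV[R]_m) : \bar R := lebesgue (frame a U @^-1` A).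

(* Boundary of V `&` W for the topology of V; the points outside V are
   isolated in subspace V, hence never in the boundary. *)
Definition boundary_in (V W : set 'rV[R]_m) : set 'rV[R]_m :=
  let A : set (subspace V) := V `&` W in closure A `\` interior A.

Definition thickening_in (V S : set 'rV[R]_m) (eta : R) : set 'rV[R]_m :=
  [set y | V y /\ exists2 z, S z & ball z eta y].

(* The thickening is relatively open in V, hence measurable. *)
Definition regular_window (W : set 'rV[R]_m) : Prop :=
  forall k (a : 'rV[R]_m) (U : 'M[R]_(k, m)), U *m U^T = 1%:M ->
    let V := affine_subspace a U in
    lebesgue_on a U (thickening_in V (boundary_in V W) eta)
      @[eta --> 0^'+] --> 0%E.

End RegularWindow.

Section ModelSet.
Context {R : realType}.

Definition is_lattice d (L : set 'rV[R]_d) : Prop :=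
  exists2 B : 'M[R]_d, B \in unitmx &
    L = [set map_mx intr z *m B | z in [set: 'rV[int]_d]].

(* With R^(m+n) = R^m x R^n, p_1 is lsubmx and p_2 is rsubmx. *)
Definition model_set m n (L : set 'rV[R]_(m + n)) (W : set 'rV[R]_m) :
  set 'rV[R]_n := [set rsubmx l | l in [set l | L l /\ W (lsubmx l)]].

Definition is_model_set n (G : set 'rV[R]_n) : Prop :=
  exists m (L : set 'rV[R]_(m + n)) (W : set 'rV[R]_m),
    [/\ (0 < m)%N, is_lattice L, lebesgue_measurable W & G = model_set L W].

End ModelSet.

Section AlmostPeriodicPattern.
Context {R : realType} {n : nat}.
Implicit Types (E G : set 'rV[R]_n) (r eps : R).

Definition relatively_dense G : Prop :=
  exists2 r0, 0 < r0 & forall x r, r0 <= r -> ball x r `&` G !=set0.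

Definition uniformly_discrete G : Prop :=
  exists2 r0, 0 < r0 &
    forall x r, 0 < r <= r0 -> is_subset1 (ball x r `&` G).

Definition delone G : Prop := relatively_dense G /\ uniformly_discrete G.

(* Vol(B_r) = (2 r)^n, B_r being a cube of side 2 r.  The value is +oo if some
   ball of radius r contains infinitely many points of E. *)
Definition upper_density r E : \bar R :=
  ereal_sup [set counting (E `&` ball x r) * (((2 * r) ^+ n)^-1)%:E
            | x in [set: 'rV[R]_n]]%E.

Definition translate G (v : 'rV[R]_n) : set 'rV[R]_n := [set x + v | x in G].

Definition almost_periods_from G eps r0 : set 'rV[R]_n :=
  [set v | forall r, r0 <= r ->
     (upper_density r (translate G v `+` G) < eps%:E)%E].

Definition almost_periods G eps : set 'rV[R]_n :=
  \bigcup_(r0 in [set r0 | 0 < r0]) almost_periods_from G eps r0.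

Definition almost_periodic_pattern G : Prop :=
  delone G /\
  forall eps, 0 < eps ->
    exists2 r0, 0 < r0 & relatively_dense (almost_periods_from G eps r0).

End AlmostPeriodicPattern.

(* Main.v *)
(* For v = p_2(lambda) with lambda in L and p_1(lambda) short, a point of the
   symmetric difference of G + v and G is p_2(l) for some l in L such that p_1(l)
   is close to the boundary of W.  More precisely, let V be the span of the short
   vectors of p_1(L): p_1(l) is close to the boundary of W inside its own coset of
   V.  By regularity the points of that coset close to the boundary are covered by
   finitely many boxes of small total volume, and since p_1(L) is dense in V each
   box contributes at most a constant times its volume times r^n points p_2(l) in a
   ball of radius r.  Regularity in R^m itself makes the boundary of W bounded,
   hence only finitely many cosets of V matter.  So the v's as above, which form a
   relatively dense model set, are almost periods. *)
Require Import Defs.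
From mathcomp Require Import all_boot all_order all_algebra.
From mathcomp Require Import all_classical all_reals all_analysis.
From mathcomp Require Import finmap lra ring.
Set Implicit Arguments.
Unset Strict Implicit.
Unset Printing Implicit Defensive.
Import Order.TTheory GRing.Theory Num.Theory.
Import numFieldNormedType.Exports.
Local Open Scope classical_set_scope.
Local Open Scope ring_scope.

(** * Cardinality bounds for sets, by injections, copies and cells *)

Section FiniteCounting.
Context {R : realType}.

(** The obstacle is that p_1(L) may be neither dense nor discrete, and that p_1 and p_2 need not be
    injective. Hence counting takes place in [L], whose points are uniformly separated, and is
    transferred to the model set along p_2. A strip of bounded width has O(r^n) lattice points over
    a ball of radius r, but this bound does not see the volume of a smaller window; the volume
    factor comes from packing disjoint translates of that window into one strip, which is possible
    only along directions where p_1(L) is dense. The radius from which the packing bound holds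
    depends on the box, so countable covers must be cut down to finite ones: this is why thickenings
    are halved, the smaller one having compact closure inside the larger. The number of cosets and
    the constant of the packing bound are fixed before the volume of the covers is chosen, so [eps]
    can be shared out among the cosets. *)

Definition card_le (T : eqType) (A : set T) (x : R) : Prop :=
  forall s : seq T, uniq s -> {in s, forall t, A t} -> (size s)%:R <= x.

Lemma card_le_sub (T : eqType) (A B : set T) (x y : R) :
  A `<=` B -> x <= y -> card_le B x -> card_le A y.
Proof.
move=> AB xy Bx s us sA; apply: le_trans xy; apply: Bx => // t ts.
exact/AB/sA.
Qed.

Lemma card_le_surj (T T' : eqType) (f : T -> T') (A : set T) (B : set T')
  (x : R) : B `<=` f @` A -> card_le A x -> card_le B x.
Proof.
move=> BfA Ax s us sB.
have [s' [s's s'A]] : exists s', map f s' = s /\ {in s', forall t, A t}.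
  elim: s sB {us} => [|t s IHs] sB; first by exists [::].
  have [u us|s' [<- s'A]] := IHs; first by apply: sB; rewrite inE us orbT.
  have [|u Au <-] := BfA t; first by apply: sB; rewrite inE eqxx.
  exists (u :: s'); split=> // v; rewrite inE => /orP[/eqP->//|]; exact: s'A.
rewrite -s's size_map; apply: Ax => //.
by apply: (@map_uniq _ _ f); rewrite s's.
Qed.

Lemma card_le_fin (T : eqType) (F : finType) (f : T -> F) (A : set T) :
  (forall s t, A s -> A t -> f s = f t -> s = t) -> card_le A #|F|%:R.
Proof.
move=> finj s us sA; rewrite ler_nat -(size_map f); apply/card_geqP.
exists (map f s); split=> //; rewrite map_inj_in_uniq // => a b /sA Aa /sA Ab.
exact: finj.
Qed.

(** Packing: the copies of [A] are disjoint subsets of [B], so a bound on [B] may be divided by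
    their number. This is the source of the volume factor in [box_strip_count]. *)
Lemma card_le_disjoint_copies (T T' : eqType) (F : finType) (h : F -> T -> T')
  (A : set T) (B : set T') (x : R) :
  (forall i t, A t -> B (h i t)) ->
  (forall i j s t, A s -> A t -> h i s = h j t -> i = j /\ s = t) ->
  card_le B (#|F|%:R * x) -> (0 < #|F|)%N -> card_le A x.
Proof.
move=> hAB hinj Bx F0 s us sA.
have F0' : 0 < #|F|%:R :> R by rewrite ltr0n.
rewrite -(ler_pM2l F0') -natrM.
have := Bx [seq h i t | i <- enum F, t <- s].
rewrite size_allpairs -cardE; apply.
  apply: allpairs_uniq => //; first exact: enum_uniq.
  move=> [i t] [j u] /allpairsP[[? ?] /= [_ tA [-> ->]]].
  move=> /allpairsP[[? ?] /= [_ uA [-> ->]]].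
  by move=> /hinj[||-> ->] //; apply: sA.
by move=> _ /allpairsP[[i t] /= [_ /sA At ->]]; apply: hAB.
Qed.

Lemma card_leU (T : eqType) (A B : set T) (x y : R) :
  card_le A x -> card_le B y -> card_le (A `|` B) (x + y).
Proof.
move=> Ax By s us sAB.
have := count_predC (fun t => `[< A t >]) s => <-.
rewrite natrD; apply: lerD; rewrite -size_filter.
  apply: Ax; first exact: filter_uniq.
  by move=> t; rewrite mem_filter => /andP[/asboolP].
apply: By; first exact: filter_uniq.
move=> t; rewrite mem_filter => /andP[/asboolPn nAt /sAB].
by case.
Qed.

Lemma card_le_bigcup (I T : eqType) (r : seq I) (A : I -> set T) (x : I -> R) :
  {in r, forall i, card_le (A i) (x i)} ->
  card_le [set t | exists2 i, i \in r & A i t] (\sum_(i <- r) x i).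
Proof.
elim: r => [|i r IHr] Ax.
  rewrite big_nil => -[|t s] //= _ /(_ t); rewrite inE eqxx => /(_ isT).
  by case.
rewrite big_cons; apply: (@card_le_sub _ _
  (A i `|` [set t | exists2 i, i \in r & A i t])) => //.
  move=> t [j]; rewrite inE => /orP[/eqP->|jr] At; first by left.
  by right; exists j.
apply: card_leU; first by apply: Ax; rewrite inE eqxx.
by apply: IHr => j jr; apply: Ax; rewrite inE jr orbT.
Qed.

(** Quantifying over duplicate-free lists lets [card_le] be proved before finiteness is known;
    finiteness is then a consequence. *)
Lemma card_le_finite (T : choiceType) (A : set T) (x : R) :
  card_le A x -> finite_set A.
Proof.
move=> Ax; apply: contrapT => infA.
have [B BA] := infinite_set_fset (Num.truncn x).+1 infA.
have := Ax (finmap.enum_fset B) (finmap.fset_uniq B) (fun t tB => BA t tB) => Bx.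
rewrite -(@ler_nat R) => /le_trans/(_ Bx).
by rewrite leNgt; case/negP; apply: truncnS_gt.
Qed.

Lemma counting_card_le (T : choiceType) (A : set T) (x : R) :
  card_le A x -> (counting A <= x%:E)%E.
Proof.
move=> Ax; have finA := card_le_finite Ax.
rewrite /counting (asboolT finA) lee_fin; apply: Ax; first exact: finmap.fset_uniq.
by move=> t; rewrite in_fset_set // => /set_mem.
Qed.

Lemma prod_card_cells (d : nat) (N : 'I_d -> nat) :
  #|{dffun forall i, 'I_(N i)}| = (\prod_i N i)%N.
Proof.
rewrite card_dep_ffun foldrE /image_mem big_map big_enum /=.
by apply: eq_bigr => i _; rewrite card_ord.
Qed.

Lemma floor_cells_inj (x y : R) : 0 <= x -> 0 <= y ->
  Num.truncn x = Num.truncn y -> `|x - y| < 1.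
Proof.
move=> /truncn_itv/andP[x1 x2] /truncn_itv/andP[y1 y2] xy.
rewrite xy -natr1 in x1 x2; rewrite -natr1 in y2.
rewrite ltr_norml; apply/andP; split; lra.
Qed.

(** Pigeonhole on unit cells: points with the same truncated coordinates coincide. Direction [i] has
    at most [l i + 1] cells, and [1 <= l i] bounds this by [2 * l i]. *)
Lemma card_le_cells (T : eqType) d (A : set T) (f : T -> 'I_d -> R)
  (l : 'I_d -> R) :
  (forall t i, A t -> 0 <= f t i <= l i) ->
  (forall s t, A s -> A t -> (forall i, `|f s i - f t i| < 1) -> s = t) ->
  (forall i, 1 <= l i) -> card_le A (\prod_i (2 * l i)).
Proof.
move=> fl finj l1.
have tr t i : A t -> (Num.truncn (f t i) < (Num.truncn (l i)).+1)%N.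
  by move=> /fl-/(_ i)/andP[_ ?]; rewrite ltnS; apply: le_truncn.
pose g t : {dffun forall i, 'I_(Num.truncn (l i)).+1} :=
  [ffun i => inord (Num.truncn (f t i))].
apply: (@card_le_sub _ _ A #|{dffun forall i, 'I_(Num.truncn (l i)).+1}|%:R) => //.
  rewrite prod_card_cells natr_prod; apply: ler_prod => i _; rewrite ler0n /=.
  have /truncn_itv/andP[lt _] : 0 <= l i by apply: le_trans (l1 i).
  by rewrite -natr1; have := l1 i; lra.
apply: (card_le_fin (f := g)) => s t As At /ffunP gst; apply: finj => // i.
apply: floor_cells_inj; [by have /andP[]:= fl _ i As|by have /andP[]:= fl _ i At|].
by have := gst i; rewrite !ffunE => /(congr1 val); rewrite /= !inordK ?tr.
Qed.

End FiniteCounting.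

(** * Sup-norm estimates and finite nets *)

Section SupNorm.
Context {R : realType}.

(** In dimension 0 this holds for every [r], even negative, whence the separate [0 < r] in
    [ball_small]. *)
Definition small k (r : R) (x : 'rV[R]_k) : Prop := forall i, `|x 0 i| < r.

Lemma ball_small k (x y : 'rV[R]_k) r : ball x r y <-> 0 < r /\ small r (y - x).
Proof.
split=> [[r0 xy]|[r0 xy]]; split=> // i; first by rewrite !mxE distrC; apply: xy.
by move=> j; rewrite (ord1 i) /ball /= distrC; have := xy j; rewrite !mxE.
Qed.

Lemma small_le k (r s : R) (x : 'rV[R]_k) : r <= s -> small r x -> small s x.
Proof. by move=> rs xr i; apply: lt_le_trans rs. Qed.

Lemma smallN k r (x : 'rV[R]_k) : small r x -> small r (- x).
Proof. by move=> xr i; rewrite mxE normrN. Qed.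

Lemma smallD k r s (x y : 'rV[R]_k) : small r x -> small s y -> small (r + s) (x + y).
Proof.
move=> xr ys i; rewrite mxE; apply: (le_lt_trans (ler_normD _ _)).
exact: ltrD.
Qed.

Lemma smallB k r s (x y : 'rV[R]_k) : small r x -> small s y -> small (r + s) (x - y).
Proof. by move=> xr ys; apply: smallD => //; apply: smallN. Qed.

Lemma small0 k r : 0 < r -> small r (0 : 'rV[R]_k).
Proof. by move=> r0 i; rewrite mxE normr0. Qed.

(** A crude bound for the operator norm in the sup norm; the summand 1 makes it positive for every
    matrix and the resulting inequalities strict. *)
Definition entry_sum k l (A : 'M[R]_(k, l)) : R := 1 + \sum_i \sum_j `|A i j|.

Lemma entry_sum_ge1 k l (A : 'M[R]_(k, l)) : 1 <= entry_sum A.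
Proof. by rewrite lerDl; apply: sumr_ge0 => i _; apply: sumr_ge0. Qed.

Lemma entry_sum_gt0 k l (A : 'M[R]_(k, l)) : 0 < entry_sum A.
Proof. exact: lt_le_trans ltr01 (entry_sum_ge1 A). Qed.

Lemma small_entry_sum k (x : 'rV[R]_k) : small (entry_sum x) x.
Proof.
move=> i; rewrite /entry_sum big_ord1 (bigD1 i) //=.
have : 0 <= \sum_(j | j != i) `|x 0 j| by apply: sumr_ge0.
lra.
Qed.

Lemma small_mulmx k l (A : 'M[R]_(k, l)) r (x : 'rV[R]_k) : 0 < r -> small r x ->
  small (r * entry_sum A) (x *m A).
Proof.
move=> r0 xr j; rewrite mxE; apply: (le_lt_trans (ler_norm_sum _ _ _)).
apply: (@le_lt_trans _ _ (r * \sum_i \sum_j `|A i j|)); last first.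
  by rewrite ltr_pM2l // ltrDr.
rewrite mulr_sumr; apply: ler_sum => i _; rewrite normrM; apply: ler_pM => //.
  exact: ltW.
by rewrite (bigD1 j) //= lerDl; apply: sumr_ge0.
Qed.

Lemma small_exists k (x : 'rV[R]_k) : exists2 r, 0 < r & small r x.
Proof. by exists (entry_sum x); [apply: entry_sum_gt0|apply: small_entry_sum]. Qed.

Lemma small_seq_bounded k (s : seq 'rV[R]_k) :
  exists2 r, 0 < r & {in s, forall x, small r x}.
Proof.
elim: s => [|x s [r r0 sr]]; first by exists 1.
have [r' r'0 xr'] := small_exists x; exists (r + r'); first exact: addr_gt0.
move=> y; rewrite inE => /orP[/eqP->|/sr].
  by apply: small_le xr'; rewrite lerDr ltW.
by apply: small_le; rewrite lerDl ltW.
Qed.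

Lemma finType_section (T : eqType) (F : finType) (g : T -> F) (A : set T) :
  exists s : seq T, {in s, forall t, A t} /\
    forall t, A t -> exists2 u, u \in s & g t = g u.
Proof.
suff : forall e : seq F, exists s : seq T, {in s, forall t, A t} /\
    forall t, A t -> g t \in e -> exists2 u, u \in s & g t = g u.
  move=> /(_ (enum F))[s [sA sF]]; exists s; split=> // t At.
  by apply: sF => //; rewrite mem_enum.
elim=> [|c e [s [sA se]]]; first by exists [::]; split.
have [[u [Au guc]]|noc] := pselect (exists u, A u /\ g u = c); last first.
  exists s; split=> // t At; rewrite inE => /orP[/eqP gtc|]; last exact: se.
  by case: noc; exists t.
exists (u :: s); split=> [t|t At]; first by rewrite inE => /orP[/eqP->//|/sA].
rewrite inE => /orP[/eqP->|/(se _ At)[v vs gtv]].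
  by exists u => //; rewrite inE eqxx.
by exists v => //; rewrite inE vs orbT.
Qed.

(** One representative is chosen in each nonempty cell of side [delta]. It is taken in [A] itself,
    so that for a set of lattice vectors the differences from the net are lattice vectors too. *)
Lemma small_net k (T : eqType) (f : T -> 'rV[R]_k) (A : set T) (rho delta : R) :
  0 < delta -> (forall t, A t -> small rho (f t)) ->
  exists s : seq T, {in s, forall t, A t} /\
    forall t, A t -> exists2 u, u \in s & small delta (f t - f u).
Proof.
move=> delta0 Arho; pose N := Num.truncn (2 * rho / delta).
pose h t i := (f t 0 i + rho) / delta.
pose g t : {ffun 'I_k -> 'I_N.+1} := [ffun i => inord (Num.truncn (h t i))].
have h0 t i : A t -> 0 <= h t i.
  move=> /Arho/(_ i); rewrite ltr_norml => /andP[t1 t2].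
  by rewrite divr_ge0 // ?ltW //; lra.
have hN t i : A t -> (Num.truncn (h t i) < N.+1)%N.
  move=> /Arho/(_ i); rewrite ltr_norml => /andP[t1 t2].
  by rewrite ltnS; apply: le_truncn; rewrite ler_pM2r ?invr_gt0 //; lra.
have [s [sA As]] := finType_section g A.
exists s; split=> // t At; have [u us /ffunP gtu] := As t At.
exists u => // i; have Au := sA u us.
have := gtu i; rewrite !ffunE => /(congr1 val); rewrite /= !inordK ?hN //.
move=> /(floor_cells_inj (h0 t i At) (h0 u i Au)).
rewrite /h -mulrBl normrM normfV (gtr0_norm delta0) ltr_pdivrMr // mul1r.
by rewrite !mxE opprD addrACA subrr addr0.
Qed.

End SupNorm.

(** * Lattices: separation, covering radius, points in a strip *)

Section Lattices.
Context {R : realType}.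

Section OneLattice.
Variables (d : nat) (L : set 'rV[R]_d).
Hypothesis L_lattice : is_lattice L.

Lemma lattice0 : L 0.
Proof. by case: L_lattice => B _ ->; exists 0 => //; rewrite map_mx0 mul0mx. Qed.

Lemma latticeB x y : L x -> L y -> L (x - y).
Proof.
case: L_lattice => B _ -> [z _ <-] [w _ <-].
by exists (z - w) => //; rewrite map_mxB mulmxBl.
Qed.

Lemma latticeN x : L x -> L (- x).
Proof. by rewrite -sub0r => Lx; apply: latticeB => //; apply: lattice0. Qed.

Lemma latticeD x y : L x -> L y -> L (x + y).
Proof. by move=> Lx Ly; rewrite -[y]opprK; apply: latticeB => //; apply: latticeN. Qed.

Lemma latticeMn x n : L x -> L (x *+ n).
Proof.
by move=> Lx; elim: n => [|n IHn]; [apply: lattice0|rewrite mulrS; apply: latticeD].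
Qed.

Lemma latticeMz x (z : int) : L x -> L (x *~ z).
Proof.
case: z => n Lx; [exact: latticeMn|].
by rewrite NegzE mulrNz; apply: latticeN; apply: latticeMn.
Qed.

Lemma lattice_sum (I : Type) (r : seq I) (F : I -> 'rV[R]_d) :
  (forall i, L (F i)) -> L (\sum_(i <- r) F i).
Proof.
move=> LF; elim: r => [|i r IHr]; first by rewrite big_nil; apply: lattice0.
by rewrite big_cons; apply: latticeD.
Qed.

(** In a basis of the lattice a short enough vector has integer coordinates of modulus less than
    1. *)
Lemma lattice_separated :
  exists2 delta, 0 < delta & forall l, L l -> small delta l -> l = 0.
Proof.
case: L_lattice => B Bu ->; exists (entry_sum (invmx B))^-1.
  by rewrite invr_gt0 entry_sum_gt0.
move=> _ [z _ <-] /small_mulmx-/(_ _ (invmx B)).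
rewrite invr_gt0 entry_sum_gt0 mulVf ?gt_eqF ?entry_sum_gt0 // mulmxK // => z1.
suff -> : z = 0 by rewrite map_mx0 mul0mx.
apply/rowP => i; have := z1 isT i; rewrite !mxE -intr_norm.
rewrite -[1]/(1%:~R) ltr_int -[X in _ < X -> _]add0r ltzD1 normr_le0.
by move/eqP.
Qed.

Lemma lattice_covering :
  exists2 C, 0 < C & forall y, exists2 l, L l & small C (y - l).
Proof.
case: L_lattice => B Bu ->; exists (1 * entry_sum B).
  by rewrite mul1r entry_sum_gt0.
move=> y; pose w := y *m invmx B.
exists (map_mx intr (\row_i Num.floor (w 0 i)) *m B); first by eexists.
set z := map_mx _ _.
have -> : y - z *m B = (w - z) *m B by rewrite mulmxBl mulmxKV.
rewrite {}/z; clearbody w; apply: small_mulmx => // i; rewrite !mxE.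
have /andP[] := floor_itv (w 0 i); rewrite intrD mulr1z => z1 z2.
rewrite ltr_norml; apply/andP; split; lra.
Qed.

End OneLattice.

(** Rescaling by [delta^-1] puts distinct lattice points into distinct unit cells. The [m] bounded
    directions contribute a constant, the [n] others O(r) each, where [1 <= r] absorbs the additive
    constant. *)
Lemma strip_count m n (L : set 'rV[R]_(m + n)) : is_lattice L ->
  forall rho : R, 0 < rho -> exists2 C : R, 0 < C & forall (x : 'rV[R]_n) r, 1 <= r ->
    card_le [set l | [/\ L l, small rho (lsubmx l) & small r (rsubmx l - x)]]
      (C * r ^+ n).
Proof.
move=> L_lattice rho rho0; have [delta delta0 Lsep] := lattice_separated L_lattice.
pose K := delta^-1; have K0 : 0 < K by rewrite invr_gt0.
have Krho0 : 0 < K * rho by apply: mulr_gt0.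
exists ((2 * (2 * (K * rho) + 1)) ^+ m * (2 * (2 * K + 1)) ^+ n).
  by apply: mulr_gt0; apply: exprn_gt0; lra.
move=> x r r1.
have K0r : 0 < K * r by apply: mulr_gt0 => //; lra.
pose w (i : 'I_(m + n)) : R := row_mx (const_mx rho) (const_mx r) (0 : 'I_1) i.
pose c (i : 'I_(m + n)) : R := row_mx 0 x (0 : 'I_1) i.
apply: (@card_le_sub _ _ _ [set l | L l /\ forall i, `|l 0 i - c i| < w i]
  (\prod_i (2 * (2 * (K * w i) + 1)))).
- move=> l [Ll l1 l2]; split=> // i; rewrite /c /w; case: (split_ordP i) => j ->.
    by rewrite !row_mxEl !mxE subr0; have := l1 j; rewrite !mxE.
  by rewrite !row_mxEr !mxE; have := l2 j; rewrite !mxE.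
- rewrite big_split_ord /=.
  under eq_bigr do rewrite /w row_mxEl mxE.
  under [X in _ * X]eq_bigr do rewrite /w row_mxEr mxE.
  rewrite !prodr_const !card_ord -mulrA -exprMn; apply: ler_wpM2l.
    by apply: exprn_ge0; lra.
  by apply: lerXn2r; rewrite ?nnegrE; nra.
have wi0 i : 0 < w i.
  rewrite /w; case: (split_ordP i) => j ->; first by rewrite row_mxEl mxE.
  by rewrite row_mxEr mxE; lra.
apply: (@card_le_cells R _ _ _ (fun (l : 'rV[R]_(m + n)) i => K * (l 0 i - c i + w i))
  (fun i => 2 * (K * w i) + 1)).
- move=> l i [_ /(_ i)]; rewrite ltr_norml => /andP[l1 l2]; apply/andP; split.
    by apply: mulr_ge0; [exact: ltW|lra].
  by rewrite -[leLHS]addr0; apply: lerD => //; rewrite mulrCA ler_pM2l //; lra.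
- move=> l l' [Ll _] [Ll' _] ll'; apply/eqP; rewrite -subr_eq0; apply/eqP/Lsep.
    exact: latticeB.
  move=> i; have := ll' i; rewrite -mulrBr opprD addrACA subrr addr0.
  rewrite opprD addrACA subrr addr0 normrM (gtr0_norm K0) /K mulrC.
  by rewrite ltr_pdivrMr // mul1r !mxE.
- by move=> i; rewrite lerDr mulr_ge0 // ltW // mulr_gt0.
Qed.

End Lattices.

(** * The subspace in which p_1(L) is dense *)

Section DenseDirections.
Context {R : realType}.

(** A row that depends on the others is dropped. Orthonormal rows are what [regular_window] asks of
    a frame. *)
Lemma gram_schmidt k m (A : 'M[R]_(k, m)) :
  exists k' (U : 'M[R]_(k', m)), U *m U^T = 1%:M /\ (U :=: A)%MS.
Proof.
elim: k A => [|k IHk] A.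
  by exists 0%N, A; split=> //; apply/matrixP => -[].
rewrite -[A](@vsubmxK _ 1 k m); move: (usubmx _) (dsubmx _) => a {}A.
have [k' [U [UU1 UA]]] := IHk A.
have sumU : (a + U :=: col_mx a A)%MS.
  by apply: eqmx_trans (addsmxE _ _); apply: adds_eqmx.
have [w [wE wU0]] : exists w, w = a - a *m U^T *m U /\ w *m U^T = 0.
  by eexists; split; rewrite // mulmxBl -(mulmxA (a *m U^T)) UU1 mulmx1 subrr.
have aw : a = w + a *m U^T *m U by rewrite wE subrK.
have [w0|w0] := eqVneq w 0.
  exists k', U; split=> //; apply: eqmx_trans sumU.
  by apply/eqmx_sym/addsmx_idPr; rewrite aw w0 add0r submxMl.
pose s := \sum_i w 0 i ^+ 2.
have s0 : 0 < s.
  rewrite lt_neqAle sumr_ge0 ?andbT => [|i _]; last exact: sqr_ge0.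
  apply: contra w0; rewrite eq_sym psumr_eq0 => [/allP w0|i _]; last exact: sqr_ge0.
  apply/eqP/rowP => i; have := w0 i (mem_index_enum i).
  by rewrite /= sqrf_eq0 => /eqP->; rewrite mxE.
have sq0 : Num.sqrt s != 0 by rewrite gt_eqF // sqrtr_gt0.
have wwT : w *m w^T = s%:M.
  apply/matrixP => i j; rewrite !ord1 !mxE eqxx mulr1n.
  by apply: eq_bigr => l _; rewrite mxE expr2.
exists (1 + k')%N, (col_mx ((Num.sqrt s)^-1 *: w) U); split.
  rewrite tr_col_mx mul_col_row UU1.
  have -> : ((Num.sqrt s)^-1 *: w)^T = (Num.sqrt s)^-1 *: w^T by rewrite linearZ.
  rewrite -!scalemxAl wU0 -!scalemxAr wwT.
  have -> : U *m w^T = 0 by rewrite -[U]trmxK -trmx_mul wU0 trmx0.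
  rewrite !scaler0 scalerA -invfM -expr2 sqr_sqrtr ?ltW // scale_scalar_mx.
  by rewrite mulVf ?gt_eqF // -scalar_mx_block.
apply: eqmx_trans sumU; apply: eqmx_trans (eqmx_sym (addsmxE _ _)) _.
apply/eqmxP/andP; split; rewrite addsmx_sub addsmxSr andbT.
  apply: scalemx_sub; rewrite wE addmx_sub ?addsmxSl // -mulNmx.
  by apply: mulmx_sub; apply: addsmxSr.
rewrite {1}aw addmx_sub //; last by apply: mulmx_sub; apply: addsmxSr.
apply: submx_trans (addsmxSl _ _).
by rewrite -{1}[w]scale1r -(mulfV sq0) -scalerA scalemx_sub.
Qed.

Lemma row_free_col_mx k m (a : 'rV[R]_m) (A : 'M[R]_(k, m)) :
  row_free A -> ~~ (a <= A)%MS -> row_free (col_mx a A).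
Proof.
move=> fA aA; have ltA : (A < a + A)%MS.
  by rewrite /ltmx addsmxSr addsmx_sub submx_refl andbT.
have := ltmxErank A (a + A)%MS; rewrite ltA => /esym/andP[_ rkA].
rewrite /row_free eqn_leq rank_leq_row /= -addsmxE.
by rewrite -{1}(eqP fA).
Qed.

(* The row space of U is the span of the vectors of p_1(L) of length < delta; it
   does not depend on delta once delta is small, as its dimension can only drop. *)
Lemma dense_directions m n (L : set 'rV[R]_(m + n)) : is_lattice L ->
  exists k (U : 'M[R]_(k, m)) (delta : R), [/\ 0 < delta, U *m U^T = 1%:M,
    forall l, L l -> small delta (lsubmx l) -> exists t, lsubmx l = t *m U &
    forall (t : 'rV[R]_k) eps, 0 < eps -> exists2 l, L l &
      exists2 t', lsubmx l = t' *m U & small eps (t' - t)].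
Proof.
move=> L_lattice.
(* [P k]: at every scale, p_1(L) has [k] independent vectors of that length. For the largest such
   [k] some scale [delta] admits no [k + 1] of them, so every vector shorter than [delta] lies in
   the span of any [k] of them. *)
pose P k := forall delta, 0 < delta -> exists2 A : 'M[R]_(k, m), row_free A &
  forall i, exists2 l, L l & lsubmx l = row i A /\ small delta (row i A).
have exP : exists k, `[< P k >].
  by exists 0%N; apply/asboolP => delta _; exists 0; [rewrite /row_free mxrank0|case].
have P_le_m k : `[< P k >] -> (k <= m)%N.
  move=> /asboolP/(_ 1 ltr01)[A /eqP fA _].
  exact: leq_trans (eq_leq (esym fA)) (rank_leq_col A).
have [k /asboolP Pk k_max] := ex_maxnP exP P_le_m.
have [delta [delta0 noA]] : exists delta, 0 < delta /\ ~ exists2 A : 'M[R]_(1 + k, m),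
    row_free A & forall i, exists2 l, L l & lsubmx l = row i A /\ small delta (row i A).
  apply: contrapT => noP; suff /k_max : `[< P (1 + k)%N >] by rewrite add1n ltnn.
  apply/asboolP => delta delta0; apply: contrapT => noA; apply: noP.
  by exists delta.
have [A fA Arow] := Pk _ delta0.
have [k' [U [UU1 UA]]] := gram_schmidt A.
have subU l : L l -> small delta (lsubmx l) -> (lsubmx l <= U)%MS.
  move=> Ll ldelta; rewrite UA; apply: contrapT => /negP lA; apply: noA.
  exists (col_mx (lsubmx l) A); first exact: row_free_col_mx.
  move=> i; case: (split_ordP i) => j ->.
    by exists l => //; rewrite rowKu row_id.
  by have [l' Ll' [l'A l's]] := Arow j; exists l' => //; rewrite rowKd.
exists k', U, delta; split=> // [l Ll /(subU l Ll)/submxP // |t eps eps0].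
(* Rounding the coordinates in a basis [B] of vectors shorter than [eps / c] moves a point by at
   most [k * (eps / c)], and [entry_sum U^T] converts this to coordinates along [U]. Using [k.+1]
   keeps the inequality strict when [k = 0]. *)
pose c := k.+1%:R * entry_sum U^T.
have c0 : 0 < c by rewrite mulr_gt0 ?entry_sum_gt0 ?ltr0n.
have eps'0 : 0 < Num.min delta (eps / c) by rewrite lt_min delta0 divr_gt0.
have [B fB Brow] := Pk _ eps'0.
have BU : (B <= U)%MS.
  apply/row_subP => i; have [l Ll [<- ls]] := Brow i; apply: subU => //.
  by apply: small_le ls; rewrite ge_min lexx.
(* The span is the same at the finer scale, since the ranks agree. *)
have UB : (U <= B)%MS.
  have /eqmxP/andP[] // : (B :=: U)%MS.
  apply/eqmxP; rewrite BU andTb.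
  rewrite -(mxrank_leqif_sup BU).2.
  by rewrite UA (eqP fB) (eqP fA).
have [s tUs] := submxP (submx_trans (submxMl t U) UB).
have [z zE] : exists z : 'rV[int]_k, forall i, z 0 i = Num.floor (s 0 i).
  by exists (\row_i Num.floor (s 0 i)) => i; rewrite mxE.
have /choice[l lP] : forall i, exists v, [/\ L v, lsubmx v = row i B &
    small (Num.min delta (eps / c)) (row i B)].
  by move=> i; have [v ? []] := Brow i; exists v.
have lz : lsubmx (\sum_i l i *~ z 0 i) = map_mx intr z *m B.
  rewrite linear_sum mulmx_sum_row; apply: eq_bigr => i _.
  have [_ lB _] := lP i; by rewrite raddfMz /= mxE scaler_int -lB.
have [t' lt'] : exists t', lsubmx (\sum_i l i *~ z 0 i) = t' *m U.
  by rewrite lz; apply/submxP; apply: submx_trans BU; apply: submxMl.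
exists (\sum_i l i *~ z 0 i).
  by apply: lattice_sum => // i; apply: latticeMz => //; have [] := lP i.
exists t' => //.
have -> : t' - t = ((map_mx intr z - s) *m B) *m U^T.
  by rewrite mulmxBl -tUs -lz lt' -mulmxBl -mulmxA UU1 mulmx1.
have -> : eps = (k.+1%:R * (eps / c)) * entry_sum U^T.
  by rewrite mulrAC mulrCA mulfV ?mulr1 ?gt_eqF.
apply: small_mulmx; first by rewrite mulr_gt0 ?divr_gt0 ?ltr0n.
move=> j; rewrite mxE; apply: (le_lt_trans (ler_norm_sum _ _ _)).
apply: (@le_lt_trans _ _ (\sum_(i < k) (eps / c))); last first.
  by rewrite sumr_const card_ord -[X in X < _]mulr_natl ltr_pM2r ?divr_gt0 // ltr_nat.
apply: ler_sum => i _; rewrite normrM -[leRHS]mul1r; apply: ler_pM => //.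
  rewrite !mxE zE; have /andP[] := floor_itv (s 0 i); rewrite intrD mulr1z => z1 z2.
  by rewrite ler_norml; apply/andP; split; lra.
have [_ _ /(_ j)] := lP i; rewrite mxE => /ltW/le_trans; apply.
by rewrite ge_min lexx orbT.
Qed.

End DenseDirections.

(** * From countable to finite box covers *)

Section FiniteBoxCovers.
Context {R : realType}.

Definition nondegenerate k (p : 'rV[R]_k * 'rV[R]_k) : Prop :=
  forall i, p.1 0 i < p.2 0 i.

Lemma box_volume_ge0 k (p : 'rV[R]_k * 'rV[R]_k) :
  (forall i, p.1 0 i <= p.2 0 i) -> 0 <= box_volume p.
Proof. by move=> p12; apply: prodr_ge0 => i _; rewrite subr_ge0. Qed.

Definition fatten k (h : R) (p : 'rV[R]_k * 'rV[R]_k) : 'rV[R]_k * 'rV[R]_k :=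
  (p.1 - const_mx h, p.2 + const_mx h).

Lemma box_volume_fatten k (p : 'rV[R]_k * 'rV[R]_k) (e : R) : 0 < e ->
  exists2 h, 0 < h & box_volume (fatten h p) < box_volume p + e.
Proof.
move=> e0.
have : \prod_(i < k) (p.2 0 i - p.1 0 i + 2 * h) @[h --> (0 : R)] -->
    box_volume p.
  rewrite [box_volume p](_ : _ = \prod_(i < k) (p.2 0 i - p.1 0 i + 2 * 0)); last first.
    by apply: eq_bigr => i _; rewrite mulr0 addr0.
  apply: cvg_big => [|i _]; first exact: mul_continuous.
  by apply: cvgD; [exact: cvg_cst|apply: cvgM; [exact: cvg_cst|exact: cvg_id]].
move=> /cvgrPdist_lt/(_ e e0)/nbhs_ballP[d /= d0 hd].
exists (d / 2); first exact: divr_gt0.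
have /hd : ball (0 : R) d (d / 2).
  by rewrite /ball /= sub0r normrN gtr0_norm ?divr_gt0 //; lra.
rewrite distrC ltr_norml => /andP[_]; rewrite ltrBlDl.
apply: le_lt_trans; rewrite le_eqVlt; apply/orP; left; apply/eqP.
by apply: eq_bigr => i _; rewrite !mxE; ring.
Qed.

Lemma sum_geometric_uniq (s : seq nat) : uniq s ->
  \sum_(i <- s) 2^-1 ^+ i.+1 <= 1 :> R.
Proof.
move=> us; pose N := (\max_(i <- s) i.+1)%N.
have sN i : i \in s -> (i < N)%N.
  by move=> si; rewrite /N (big_rem i) //= leq_maxl.
rewrite (perm_big [seq i <- iota 0 N | i \in s]) /=; last first.
  apply: uniq_perm => //; first by rewrite filter_uniq // iota_uniq.
  by move=> i; rewrite mem_filter mem_iota /=; case si : (i \in s) => //=; rewrite sN.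
rewrite big_filter.
apply: (@le_trans _ _ (\sum_(i <- iota 0 N) 2^-1 ^+ i.+1)).
  by rewrite big_mkcond /=; apply: ler_sum => i _; case: ifP => // _; rewrite exprn_ge0.
suff -> : \sum_(i <- iota 0 N) 2^-1 ^+ i.+1 = 1 - 2^-1 ^+ N :> R.
  by rewrite lerBlDl lerDr exprn_ge0.
elim: (N) => [|M IHM]; first by rewrite big_nil expr0 subrr.
by rewrite -addn1 iotaD big_cat /= IHM big_seq1 add0n addn1 exprS; field.
Qed.

(** The slack between [v] and the volume of a countable cover is spent on fattening its boxes, in
    geometric shares; their interiors then form an open cover of [K]. Fattening also makes
    degenerate boxes nondegenerate, so that it is legitimate to divide by their sides later. *)
Lemma compact_box_cover k (A K : set 'rV[R]_k) (v : R) :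
  (lebesgue A < v%:E)%E -> compact K -> K `<=` A ->
  exists s : seq ('rV[R]_k * 'rV[R]_k),
    [/\ {in s, forall p, nondegenerate p},
        forall x, K x -> exists2 p, p \in s & box p x &
        \sum_(p <- s) box_volume p < v].
Proof.
move=> /ereal_inf_lt[_ [D [/countable_injP[idx idx_inj] Dle AD] <-] Dv] cK KA.
have vol0 p : D p -> (0 <= (box_volume p)%:E)%E.
  by move=> /Dle p12; rewrite lee_fin; apply: box_volume_ge0.
have [w wE] : exists w, \esum_(p in D) (box_volume p)%:E = w%:E.
  have := esum_ge0 vol0; move: Dv; case: esum => // w _ _; by exists w.
rewrite wE lte_fin in Dv.
have : forall p, exists h, 0 < h /\
    box_volume (fatten h p) < box_volume p + (v - w) * 2^-1 ^+ (idx p).+1.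
  move=> p; have [|h h0 hp] := @box_volume_fatten _ p ((v - w) * 2^-1 ^+ (idx p).+1).
    by rewrite mulr_gt0 ?subr_gt0 // exprn_gt0.
  by exists h.
move=> /choice[h hP].
have p_fat p x : box p x -> interior (box (fatten (h p) p)) x.
  move=> px; apply/nbhs_ballP; exists (h p); first by have [] := hP p.
  move=> y /ball_small[_ xy] i; rewrite !mxE; have := px i; have := xy i.
  by rewrite !mxE ltr_norml => /andP[? ?] /andP[? ?]; apply/andP; split; lra.
have := cK; rewrite compact_cover => /(_ _ D (fun p => interior (box (fatten (h p) p)))).
case=> [p _|x /KA/AD[p Dp /p_fat px]|F FD KF].
- exact: open_interior.
- by exists p.
exists [seq fatten (h p) p | p <- finmap.enum_fset F]; split.
- move=> _ /mapP[p /FD/set_mem pD ->] i.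
  by rewrite !mxE; have := Dle p pD i; have [] := hP p; lra.
- move=> x /KF[p pF /interior_subset px].
  by exists (fatten (h p) p) => //; apply: map_f.
rewrite big_map.
(* The strict inequality below comes from one fattened box, so the empty subcover is treated
   apart. *)
have [F0|F0] := eqVneq (finmap.enum_fset F) [::].
  rewrite F0 big_nil; apply: le_lt_trans Dv; rewrite -lee_fin -wE.
  exact: esum_ge0.
apply: (@lt_le_trans _ _ (\sum_(p <- finmap.enum_fset F)
    (box_volume p + (v - w) * 2^-1 ^+ (idx p).+1))).
  case: (finmap.enum_fset F) F0 => // p s _; rewrite !big_cons.
  apply: ltr_leD; first by have [] := hP p.
  by apply: ler_sum => q _; apply: ltW; have [] := hP q.
rewrite big_split /= -mulr_sumr -[leRHS](subrK w) addrC; apply: lerD.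
  rewrite -[leRHS]mulr1 ler_pM2l ?subr_gt0 //.
  have := @sum_geometric_uniq [seq idx p | p <- finmap.enum_fset F].
  rewrite big_map; apply; rewrite map_inj_in_uniq ?finmap.fset_uniq //.
  by move=> p q /FD pD /FD qD; apply: idx_inj.
rewrite -lee_fin -wE; apply: esum_ge; exists [set` F].
  by split; [exact: finite_fset|move=> p /FD/set_mem].
rewrite fsbig_finite; last exact: finite_fset.
by rewrite set_fsetK sumEFin.
Qed.

End FiniteBoxCovers.

(** * Relative boundaries and segments that cross them *)

Section Boundaries.
Context {R : realType} {m : nat}.
Implicit Types V W : set 'rV[R]_m.

Lemma boundary_inP V W z : boundary_in V W z <-> V z /\ forall e, 0 < e ->
  (exists2 y, V y /\ W y & small e (y - z)) /\
  (exists2 y, V y /\ ~ W y & small e (y - z)).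
Proof.
rewrite /boundary_in /=.
have nbhsE (B : set (subspace V)) : V z ->
    nbhs (z : subspace V) B = within V (nbhs z) B.
  by move=> Vz; rewrite (nbhs_subspace_in Vz).
split.
- move=> [clz intz].
  have Vz : V z.
    apply: contrapT => nVz.
    have [|y [[Vy _] yz]] := clz [set z : subspace V].
      suff : globally [set z] [set z] by rewrite (nbhs_subspace_out nVz).
      by move=> y ->.
    by apply: nVz; rewrite -yz.
  split=> // e e0; split.
    have [|y [[Vy Wy] /ball_small[_ yz]]] := clz (ball (z : 'rV[R]_m) e : set 'rV[R]_m).
      by rewrite nbhsE //; apply/nbhs_ballP; exists e.
    by exists y.
  apply: contrapT => noy; apply: intz; rewrite /interior nbhsE //.
  apply/nbhs_ballP; exists e => //= y /ball_small[_ yz] Vy; split=> //.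
  by apply: contrapT => nWy; apply: noy; exists y.
- move=> [Vz Hz]; split.
    move=> B; rewrite nbhsE // => /nbhs_ballP[e /= e0 eB].
    have [[y [Vy Wy] yz] _] := Hz e e0.
    by exists y; split=> //; apply: eB => //; apply/ball_small.
  rewrite /interior nbhsE // => /nbhs_ballP[e /= e0 eB].
  have [_ [y [Vy nWy] yz]] := Hz e e0; apply: nWy.
  by have [|_] := eB y _ Vy => //; apply/ball_small.
Qed.

(** The boundary point is at the supremum [t] of the parameters at which the segment from [p] to [q]
    is in [W]. *)
Lemma boundary_crossing V W p q (eta : R) :
  (forall s : R, 0 <= s <= 1 -> V (p + s *: (q - p))) -> W p -> ~ W q ->
  0 < eta -> small eta (q - p) ->
  exists z, [/\ boundary_in V W z, small eta (z - p) & small eta (z - q)].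
Proof.
move=> Vpq Wp nWq eta0 pq.
pose g s := p + s *: (q - p).
pose S := [set s : R | 0 <= s <= 1 /\ W (g s)].
have S0 : S 0 by split; rewrite ?lexx ?ler01 // /g scale0r addr0.
have ubS : ubound S 1 by move=> s [/andP[]].
have hS : has_sup S by split; [exists 0|exists 1].
set t := sup S.
have t0 : 0 <= t by apply: ub_le_sup => //; exists 1.
have t1 : t <= 1 by apply: ge_sup => //; exists 0.
have [M M0 pqM] := small_exists (q - p).
have g_near (s : R) e : 0 < e -> `|s - t| < e / M -> small e (g s - g t).
  move=> e0 st i; rewrite /g opprD addrACA subrr add0r -scalerBl mxE normrM.
  rewrite ltr_pdivlMr // in st; apply: le_lt_trans st.
  by apply: ler_wpM2l => //; apply: ltW.
exists (g t); split.
- apply/boundary_inP; split; first by apply: Vpq; rewrite t0 t1.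
  move=> e e0; have eM : 0 < e / M by apply: divr_gt0.
  split.
    have [s Ss st] := sup_adherent eM hS.
    have ts : s <= t by apply: ub_le_sup => //; exists 1.
    exists (g s); first by have [s01 Ws] := Ss; split=> //; apply: Vpq.
    by apply: g_near => //; rewrite ltr_norml -/t in st *; apply/andP; split; lra.
  (* Just beyond [t] the segment is outside [W]; if there is no room left before the parameter 1,
     then [q] itself is the nearby point outside [W]. *)
  have [tM|tM] := ltP (t + e / M / 2) 1.
    exists (g (t + e / M / 2)).
      split; first by apply: Vpq; apply/andP; split; lra.
      move=> Wt; have : S (t + e / M / 2) by split=> //; apply/andP; split; lra.
      by move=> /(ub_le_sup (ex_intro _ 1 ubS)); rewrite -/t; lra.
    apply: g_near => //; rewrite addrAC subrr add0r gtr0_norm ?divr_gt0 //.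
    lra.
  exists (g 1).
    split; first by apply: Vpq; rewrite ler01 lexx.
    by rewrite /g scale1r subrKC.
  by apply: g_near => //; rewrite ger0_norm; lra.
- move=> i; rewrite /g addrAC subrr add0r mxE normrM ger0_norm //.
  apply: le_lt_trans (pq i); rewrite -[leRHS]mul1r; exact: ler_wpM2r.
- have -> : g t - q = (t - 1) *: (q - p) by rewrite /g scalerBl scale1r opprB addrAC addrC.
  move=> i; rewrite mxE normrM ler0_norm ?subr_le0 //.
  apply: le_lt_trans (pq i); rewrite -[leRHS]mul1r; apply: ler_wpM2r => //.
  lra.
Qed.

End Boundaries.

(** * A set with a thickening of finite outer measure is bounded *)

Section BoundedBoundary.
Context {R : realType}.

Lemma seq_lower_bound (I : eqType) (r : seq I) (f : I -> R) :
  {in r, forall i, 0 < f i} -> exists2 h, 0 < h & {in r, forall i, h <= f i}.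
Proof.
elim: r => [|i r IHr] f0; first by exists 1.
have [|h h0 hf] := IHr; first by move=> j jr; apply: f0; rewrite in_cons jr orbT.
exists (Num.min h (f i)); first by rewrite lt_min h0 f0 // mem_head.
move=> j; rewrite in_cons ge_min => /orP[/eqP->|/hf->//].
by rewrite lexx orbT.
Qed.

Lemma nondegenerate_side k (s : seq ('rV[R]_k * 'rV[R]_k)) :
  {in s, forall p, nondegenerate p} ->
  exists2 h, 0 < h & forall p, p \in s -> forall i, h <= p.2 0 i - p.1 0 i.
Proof.
move=> s_nd.
have [|h h0 hs] := @seq_lower_bound _ [seq (p, i) | p <- s, i <- enum 'I_k]
    (fun pi => pi.1.2 0 pi.2 - pi.1.1 0 pi.2).
  by move=> _ /allpairsP[[p i] /= [ps _ ->]] /=; rewrite subr_gt0; apply: s_nd.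
exists h => // p ps i; apply: (hs (p, i)); apply/allpairsP; exists (p, i).
by rewrite mem_enum.
Qed.

Lemma compact_closure_bounded k (B : set 'rV[R]_k) (rho : R) :
  0 < rho -> (forall x, B x -> small rho x) -> compact (closure B).
Proof.
move=> rho0 Brho; apply: bounded_closed_compact; last exact: closed_closure.
have Brho2 x : closure B x -> small (rho + 1) x.
  move=> /(_ (ball x 1) (nbhsx_ballx x 1 ltr01))[y [/Brho yrho /ball_small[_ xy]]].
  by rewrite -(subKr y x); apply: smallB.
exists (rho + 1); split; first exact: num_real.
move=> M /ltW rhoM x /Brho2 xrho; rewrite /Num.norm /= mx_normrE.
apply: bigmax_le => [|[i j] _ /=]; first by apply: le_trans rhoM; lra.
by rewrite (ord1 i); apply: le_trans rhoM; apply/ltW/xrho.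
Qed.

(* Grid points of mesh 1/M are counted in two ways: every unit of volume of a
   covering box carries at most (2M)^k of them, and every cube at least a
   definite proportion of M^k. *)
Lemma separated_cubes_volume k (s : seq 'rV[R]_k) (T : set 'rV[R]_k) (v eta : R) :
  0 < eta -> uniq s ->
  {in s &, forall x y, x != y -> ~ small eta (x - y)} ->
  {in s, forall x y, small eta (y - x) -> T y} ->
  (lebesgue T < v%:E)%E -> (size s)%:R * (eta / 16) ^+ k <= v.
Proof.
move=> eta0 us s_sep sT Tv.
(* With radius [eta / 4] the cubes are disjoint, their centres being [eta]-separated, and their
   closures still lie in [T]. *)
pose B := [set y : 'rV[R]_k | exists2 x, x \in s & small (eta / 4) (y - x)].
have [rho rho0 s_rho] := small_seq_bounded s.
have [||boxes [boxes_nd boxesB boxes_v]] := compact_box_cover (K := closure B) Tv.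
- apply: (@compact_closure_bounded _ _ (rho + eta / 4)) => [|y [x xs yx]].
    by rewrite addr_gt0 ?divr_gt0.
  by rewrite -[y](subrKC x); apply: smallD => //; apply: s_rho.
- move=> y /(_ (ball y (eta / 4)))[|z [[x xs zx] /ball_small[_ zy]]].
    by apply: nbhsx_ballx; apply: divr_gt0.
  apply: (sT x xs).
  have -> : y - x = (z - x) - (z - y) by rewrite opprB [RHS]addrC subrKA.
  apply: (@small_le _ _ (eta / 4 + eta / 4)); last exact: smallB.
  by lra.
have [h h0 h_boxes] := nondegenerate_side boxes_nd.
(* The first summand makes every side of a covering box at least one mesh, as [card_le_cells]
   requires; the second gives each cube at least two grid steps per half-side. *)
pose M := h^-1 + 8 / eta.
have M0 : 0 < M by rewrite addr_gt0 ?invr_gt0 ?divr_gt0.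
have Mh : 1 <= M * h by rewrite mulrDl mulVf ?gt_eqF // lerDl mulr_ge0 // ?divr_ge0 // ltW.
have Meta : 8 <= M * eta.
  by rewrite mulrDl divfK ?gt_eqF // lerDr mulr_ge0 ?invr_ge0 // ltW.
pose gridpt (w : 'rV[int]_k) : 'rV[R]_k := M^-1 *: map_mx intr w.
have upper : card_le [set w | B (gridpt w)] ((2 * M) ^+ k * v).
  apply: (@card_le_sub _ _ _ [set w | exists2 p, p \in boxes & box p (gridpt w)]
      (\sum_(p <- boxes) (2 * M) ^+ k * box_volume p)).
  - by move=> w /subset_closure/boxesB.
  - by rewrite -mulr_sumr ler_pM2l ?exprn_gt0 ?mulr_gt0 // ltW.
  apply: card_le_bigcup => p p_boxes; have p_h := h_boxes p p_boxes.
  apply: (@card_le_sub _ _ _ [set w | box p (gridpt w)]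
      (\prod_i (2 * (M * (p.2 0 i - p.1 0 i))))) => //.
    rewrite /box_volume.
    under eq_bigr do rewrite mulrA.
    by rewrite big_split /= prodr_const card_ord.
  apply: (@card_le_cells _ _ _ _ (fun w i => M * (gridpt w 0 i - p.1 0 i))
      (fun i => M * (p.2 0 i - p.1 0 i))).
  - move=> w i /(_ i)/andP[w1 w2]; rewrite mulr_ge0 ?subr_ge0 ?(ltW M0) //=.
    by rewrite ler_pM2l // lerB.
  - move=> w w' _ _ ww'; apply/rowP => i; have := ww' i.
    rewrite -mulrBr opprB addrA subrK !mxE -mulrBr mulVKf ?gt_eqF //.
    rewrite -intrB -intr_norm -[1]/(1%:~R) ltr_int -[X in _ < X -> _]add0r ltzD1.
    by rewrite normr_le0 subr_eq0 => /eqP.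
  - by move=> i; apply: le_trans Mh _; rewrite ler_pM2l.
pose q := Num.truncn (M * (eta / 4)).
have Meta4 : 2 <= M * (eta / 4) by rewrite mulrA; lra.
have Meta0 : 0 <= M * (eta / 4) by apply: le_trans Meta4.
have /andP[q1 q2] := truncn_itv Meta0; rewrite -/q in q1 q2; rewrite -[q.+1%:R]natr1 in q2.
have q_ge2 : (2 <= q)%N by rewrite truncn_ge_nat.
pose pt (x : 'rV[R]_k) (c : {ffun 'I_k -> 'I_q}) : 'rV[int]_k :=
  \row_i (Num.floor (M * x 0 i) + (c i)%:Z).
have ptP x c : small (eta / 4) (gridpt (pt x c) - x).
  move=> i; rewrite -(ltr_pM2l M0) -{1}(gtr0_norm M0) -normrM !mxE.
  rewrite mulrBr mulrA mulfV ?gt_eqF // mul1r intrD.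
  have /andP[] := floor_itv (M * x 0 i); rewrite intrD mulr1z => f1 f2.
  have c1 : (c i).+1%:R <= q%:R :> R by rewrite ler_nat ltn_ord.
  have c0 : 0 <= (c i)%:R :> R by [].
  have q2' : 2 <= q%:R :> R by rewrite ler_nat.
  rewrite -natr1 in c1; rewrite -pmulrn.
  by rewrite ltr_norml; apply/andP; split; lra.
have := upper [seq pt x c | x <- s, c <- enum {ffun 'I_k -> 'I_q}].
rewrite size_allpairs -cardE card_ffun !card_ord natrM natrX => bound.
have {bound} : (size s)%:R * q%:R ^+ k <= (2 * M) ^+ k * v.
  apply: bound => [|_ /allpairsP[[x c] /= [xs _ ->]]]; last by exists x.
  apply: allpairs_uniq => //; first exact: enum_uniq.
  move=> [x c] [x' c'] /allpairsP[[? ?] /= [xs _ [xE _]]].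
  move=> /allpairsP[[? ?] /= [x's _ [x'E _]]] ptE; rewrite -xE in xs; rewrite -x'E in x's.
  have xx' : x = x'.
    apply/eqP; apply: contrapT => /negP nxx'; case: (s_sep _ _ xs x's nxx').
    have -> : x - x' = (gridpt (pt x c) - x') - (gridpt (pt x c) - x).
      by rewrite opprB [RHS]addrC subrKA.
    apply: (@small_le _ _ (eta / 4 + eta / 4)); first by lra.
    by apply: smallB; rewrite // ptE.
  rewrite -xx' in ptE *; congr (_, _); apply/ffunP => i; apply: val_inj.
  have := congr1 (fun w : 'rV_k => w 0 i) ptE; rewrite !mxE => /addrI.
  by case.
(* Truncation loses at most half of [M * (eta / 4)]. Against the factor [2 * M] of the upper bound
   the mesh cancels, leaving [eta / 16]. *)
have q_lb : M * (eta / 8) <= q%:R by lra.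
have -> : (eta / 16) ^+ k = (M * (eta / 8)) ^+ k / (2 * M) ^+ k.
  by rewrite -expr_div_n; congr (_ ^+ _); field; rewrite gt_eqF.
rewrite mulrA ler_pdivrMr ?exprn_gt0 ?mulr_gt0 // mulrC [v * _]mulrC.
apply: le_trans; rewrite mulrC; apply: ler_wpM2l => //; apply: lerXn2r => //.
  by rewrite nnegrE mulr_ge0 ?divr_ge0 // ltW.
by rewrite nnegrE.
Qed.

(** An unbounded [S] contains arbitrarily many [eta]-separated points, and the cubes around them
    force the outer measure of [T] above any [v]. *)
Lemma finite_thickening_bounded k (S T : set 'rV[R]_k) (eta : R) : 0 < eta ->
  (forall x y, S x -> small eta (y - x) -> T y) -> (lebesgue T < +oo)%E ->
  exists2 rho, 0 < rho & forall x, S x -> small rho x.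
Proof.
move=> eta0 ST Tfin; apply: contrapT => unbounded.
have far rho : 0 < rho -> exists2 x, S x & ~ small rho x.
  move=> rho0; apply: contrapT => nofar; apply: unbounded; exists rho => // x Sx.
  by apply: contrapT => xrho; apply: nofar; exists x.
have [v Tv] : exists v, (lebesgue T < v%:E)%E.
  case: (lebesgue T) Tfin => // [r _|_]; last by exists 0; apply: ltNyr.
  by exists (r + 1); rewrite lte_fin ltrDl.
have separated N : exists s : seq 'rV[R]_k, [/\ size s = N, uniq s,
    {in s, forall x, S x} & {in s &, forall x y, x != y -> ~ small eta (x - y)}].
  elim: N => [|N [s [sN us sS s_sep]]]; first by exists [::]; split.
  have [rho rho0 s_rho] := small_seq_bounded s.
  have [x Sx xfar] := far _ (addr_gt0 rho0 eta0).
  have x_sep y : y \in s -> ~ small eta (x - y).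
    move=> /s_rho yrho xy; apply: xfar.
    by rewrite -(subrKC y x); apply: smallD.
  exists (x :: s); split; rewrite /= ?sN //.
  - rewrite us andbT; apply/negP => /x_sep; apply.
    by rewrite subrr; apply: small0.
  - by move=> y; rewrite in_cons => /orP[/eqP->//|/sS].
  - move=> y z; rewrite !in_cons => /orP[/eqP->|ys] /orP[/eqP->|zs].
    + by rewrite eqxx.
    + by move=> _; apply: x_sep.
    + by move=> _ /smallN; rewrite opprB; apply: x_sep.
    + exact: s_sep.
pose c := (eta / 16) ^+ k.
have c0 : 0 < c by rewrite exprn_gt0 ?divr_gt0.
have [s [sN us sS s_sep]] := separated (Num.truncn (v / c)).+1.
have := separated_cubes_volume eta0 us s_sep _ Tv.
move=> /(_ (fun x xs y => ST x y (sS x xs))); rewrite sN -ler_pdivlMr //.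
by rewrite leNgt truncnS_gt.
Qed.

End BoundedBoundary.

(** * Lattice points over a small box *)

Section BoxStrips.
Context {R : realType}.

(* If the box has sides l_i, about prod_i 1/(2 l_i) lattice vectors translate the
   points counted here into disjoint subsets of one strip of bounded width. *)
Lemma box_strip_count m n (L : set 'rV[R]_(m + n)) k (U : 'M[R]_(k, m)) :
  is_lattice L -> U *m U^T = 1%:M ->
  (forall (t : 'rV[R]_k) eps, 0 < eps -> exists2 l, L l &
      exists2 t', lsubmx l = t' *m U & small eps (t' - t)) ->
  forall rho : R, 0 < rho -> exists2 C : R, 0 < C &
    forall (a : 'rV[R]_m) (p : 'rV[R]_k * 'rV[R]_k), nondegenerate p ->
    exists r0, forall (x : 'rV[R]_n) r, r0 <= r ->
      card_le [set l | [/\ L l, small rho (lsubmx l),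
          exists2 t, box p t & lsubmx l = a + t *m U & small r (rsubmx l - x)]]
        (C * box_volume p * r ^+ n).
Proof.
move=> L_lattice UU1 U_dense rho rho0.
have rho'0 : 0 < rho + 2 * entry_sum U by rewrite addr_gt0 ?mulr_gt0 ?entry_sum_gt0.
have [C C0 Cstrip] := strip_count L_lattice rho'0.
exists (C * 2 ^+ n * 2 ^+ k); first by rewrite !mulr_gt0 ?exprn_gt0.
move=> a p p_nd; pose side i := p.2 0 i - p.1 0 i.
have side0 i : 0 < side i by rewrite subr_gt0.
(* Translates are spaced by [2 * side i] over a length of at most 1. Spacing by twice the side
   leaves a gap of one side for approximation errors, and [N i >= (2 * side i)^-1] makes the number
   of translates at least [(2 ^+ k * box_volume p)^-1]. *)
pose N i := (Num.truncn (2 * side i)^-1).+1.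
pose F := {dffun forall i, 'I_(N i)}.
have [|h0 h00 h0_side] := @nondegenerate_side _ _ [:: p].
  by move=> q; rewrite mem_seq1 => /eqP->.
have h_side i : h0 <= side i by apply: (h0_side p); rewrite mem_head.
(* The errors of two shifts add up to less than [2 * h], at most one side, so the translates stay
   disjoint; [h <= 1] keeps every shift below 2, whence the strip width [rho + 2 * entry_sum U]. *)
pose h := Num.min 1 (h0 / 2).
have h_gt0 : 0 < h by rewrite lt_min ltr01 divr_gt0.
have : forall j : F, exists lt : 'rV[R]_(m + n) * 'rV[R]_k, [/\ L lt.1,
    lsubmx lt.1 = lt.2 *m U &
    forall i, `|lt.2 0 i - 2 * side i * (j i)%:R| < h].
  move=> j; have [l Ll [t lt tj]] := U_dense (\row_i (2 * side i * (j i)%:R)) h h_gt0.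
  by exists (l, t); split=> // i; have := tj i; rewrite !mxE.
move=> /choice[shift shiftP].
have shift2 (j : F) : small 2 (shift j).2.
  move=> i; have [_ _ /(_ i)] := shiftP j; rewrite ltr_norml => /andP[s1 s2].
  have h1 : h <= 1 by rewrite ge_min lexx.
  have jN : 2 * side i * (j i)%:R <= 1.
    rewrite mulrC -ler_pdivlMr ?mulr_gt0 // div1r -truncn_ge_nat ?invr_ge0 ?mulr_ge0 ?ltW //.
    by rewrite -ltnS ltn_ord.
  have j0 : 0 <= 2 * side i * (j i)%:R by rewrite !mulr_ge0 // ltW.
  by rewrite ltr_norml; apply/andP; split; lra.
have [r1 r10 shift_r1] := small_seq_bounded [seq rsubmx (shift j).1 | j : F].
have shift_r j : small r1 (rsubmx (shift j).1) by apply/shift_r1/map_f; rewrite mem_enum.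
(* The shifts also move p_2 by less than [r1]; once [r1 <= r], the ball grows only to radius
   [2 * r]. *)
exists (Num.max 1 r1) => x r; rewrite ge_max => /andP[r_ge1 r_ger1].
have r0 : 0 < r by apply: lt_le_trans r_ge1.
apply: (@card_le_disjoint_copies _ _ _ F (fun j l => l + (shift j).1) _
  [set l | [/\ L l, small (rho + 2 * entry_sum U) (lsubmx l) &
      small (r + r) (rsubmx l - x)]]).
- move=> j l [Ll lrho _ lr]; have [Lj jU _] := shiftP j; split.
  + exact: latticeD.
  + by rewrite raddfD /= jU; apply: smallD => //; apply: small_mulmx.
  + rewrite raddfD /= addrAC; apply: smallD => //.
    exact: small_le (shift_r j).
- move=> i j l l' [Ll _ [t pt lt] _] [Ll' _ [t' pt' lt'] _] eq_ll'.
  suff ij : i = j by split=> //; move: eq_ll'; rewrite ij => /addIr.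
  have [_ iU hi] := shiftP i; have [_ jU hj] := shiftP j.
  have eq_t : t + (shift i).2 = t' + (shift j).2.
    have : (t + (shift i).2) *m U = (t' + (shift j).2) *m U.
      apply: (@addrI _ a); rewrite !mulmxDl !addrA -lt -lt' -iU -jU -!raddfD /=.
      by rewrite eq_ll'.
    by move=> /(congr1 (mulmx^~ U^T)); rewrite -!mulmxA UU1 !mulmx1.
  apply/ffunP => c; apply: val_inj => /=; apply/eqP.
  have := congr1 (fun w : 'rV_k => w 0 c) eq_t; rewrite !mxE.
  have := hi c; have := hj c; rewrite !ltr_norml => /andP[j1 j2] /andP[i1 i2].
  have /andP[t1 t2] := pt c; have /andP[t1' t2'] := pt' c.
  have hs : 2 * h <= side c.
    apply: le_trans (h_side c); rewrite mulrC -ler_pdivlMr // ge_min lexx orbT //.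
  move=> e; have lt1 : side c * ((i c)%:R - (j c)%:R) < side c * 1.
    by rewrite /side in i1 i2 j1 j2 hs *; lra.
  have lt2 : side c * ((j c)%:R - (i c)%:R) < side c * 1.
    by rewrite /side in i1 i2 j1 j2 hs *; lra.
  rewrite ltr_pM2l // in lt1; rewrite ltr_pM2l // in lt2.
  have ij : (i c < (j c).+1)%N by rewrite -(@ltr_nat R) -[(j c).+1%:R]natr1; lra.
  have ji : (j c < (i c).+1)%N by rewrite -(@ltr_nat R) -[(i c).+1%:R]natr1; lra.
  by rewrite eqn_leq; apply/andP.
- apply: card_le_sub (Cstrip x (r + r) _) => //; last by lra.
  have -> : r + r = 2 * r by ring.
  have -> : #|F|%:R * (C * 2 ^+ n * 2 ^+ k * box_volume p * r ^+ n) =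
      C * (2 * r) ^+ n * (#|F|%:R * (2 ^+ k * box_volume p)) :> R.
    by rewrite exprMn; ring.
  rewrite -[leLHS]mulr1 ler_pM2l ?mulr_gt0 ?exprn_gt0 ?mulr_gt0 //.
  rewrite prod_card_cells natr_prod /box_volume -[k in 2 ^+ k]card_ord -prodr_const.
  rewrite -!big_split /=; apply: (@le_trans _ _ (\prod_(i < k) 1)).
    by rewrite big1.
  apply: ler_prod => i _; rewrite ler01 /=.
  have s2 : 0 < 2 * side i by rewrite mulr_gt0.
  rewrite -/(side i) -[leLHS](mulVf (lt0r_neq0 s2)) ler_pM2r // ltW //.
  exact: truncnS_gt.
- by rewrite prod_card_cells prodn_gt0.
Qed.

End BoxStrips.

(** * Lattice points near the boundary of the window *)

Section BoundaryCount.
Context {R : realType}.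

Lemma regular_small_thickening m (W : set 'rV[R]_m) k (a : 'rV[R]_m)
    (U : 'M[R]_(k, m)) (e : R) :
  regular_window W -> U *m U^T = 1%:M -> 0 < e ->
  let V := affine_subspace a U in
  exists2 eta, 0 < eta &
    (lebesgue_on a U (thickening_in V (boundary_in V W) eta) < e%:E)%E.
Proof.
move=> W_regular UU1 e0 V; have W_cvg := W_regular k a U UU1.
have : \forall eta \near 0^'+,
    (lebesgue_on a U (thickening_in V (boundary_in V W) eta) < e%:E)%E.
  apply: (W_cvg [set x | (x < e%:E)%E]); apply: open_nbhs_nbhs.
  by split; [exact: open_ereal_lt_ereal|rewrite /= lte_fin].
move=> W_near; have [eta [eta0 ?]] := filter_ex
  (filterI (nbhs_right_gt (0 : R)) W_near).
by exists eta.
Qed.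

Lemma boundary_in_full m (V W : set 'rV[R]_m) z :
  boundary_in V W z -> boundary_in (affine_subspace 0 1%:M) W z.
Proof.
have full y : affine_subspace 0 (1%:M : 'M[R]_m) y.
  by exists y => //; rewrite /frame add0r mulmx1.
move=> /boundary_inP[_ Vz]; apply/boundary_inP; split=> // e e0.
have [[y [_ Wy] yz] [y' [_ Wy'] y'z]] := Vz e e0.
by split; [exists y|exists y'].
Qed.

Lemma regular_boundary_bounded m (W : set 'rV[R]_m) : regular_window W ->
  exists2 rho, 0 < rho & forall V z, boundary_in V W z -> small rho z.
Proof.
move=> W_regular; set V := affine_subspace 0 (1%:M : 'M[R]_m).
have [|eta eta0 W_eta] := regular_small_thickening 0 (U := 1%:M) W_regular _ ltr01.
  by rewrite trmx1 mulmx1.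
have frameE y : frame 0 (1%:M : 'M[R]_m) y = y by rewrite /frame add0r mulmx1.
have [|rho rho0 rhoP] := @finite_thickening_bounded _ _ (boundary_in V W) _ _ eta0
    _ (lt_trans W_eta (ltry _)).
- move=> z y Vz yz; split; first by exists y.
  by exists z => //; apply/ball_small; rewrite frameE.
by exists rho => // V' z /boundary_in_full/rhoP.
Qed.

Lemma seq_common_threshold (I : eqType) (s : seq I) (P : I -> R -> Prop) :
  {in s, forall i, exists b, forall c, b <= c -> P i c} ->
  exists b, {in s, forall i c, b <= c -> P i c}.
Proof.
elim: s => [|i s IHs] Ps; first by exists 0.
have [|b bs] := IHs; first by move=> j js; apply: Ps; rewrite in_cons js orbT.
have [b' b'i] := Ps i (mem_head _ _).
exists (Num.max b b') => j; rewrite in_cons => /orP[/eqP->|js] c.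
  by rewrite ge_max => /andP[_]; apply: b'i.
by rewrite ge_max => /andP[bc _]; apply: bs.
Qed.

(** Regularity makes the thickening of width [eta] small. The closure of the one of width [eta / 2]
    is compact and inside it, so finitely many boxes of total volume less than [e] cover it, and the
    largest of their thresholds serves for all. *)
Lemma coset_boundary_count m n (L : set 'rV[R]_(m + n)) (W : set 'rV[R]_m) k
    (U : 'M[R]_(k, m)) (rho C : R) :
  0 < rho -> 0 < C -> regular_window W -> U *m U^T = 1%:M ->
  (forall V z, boundary_in V W z -> small rho z) ->
  (forall (a : 'rV[R]_m) (p : 'rV[R]_k * 'rV[R]_k), nondegenerate p ->
    exists r0, forall (x : 'rV[R]_n) r, r0 <= r ->
      card_le [set l | [/\ L l, small rho (lsubmx l),
          exists2 t, box p t & lsubmx l = a + t *m U & small r (rsubmx l - x)]]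
        (C * box_volume p * r ^+ n)) ->
  forall (a : 'rV[R]_m) (e : R), 0 < e ->
  let V := affine_subspace a U in
  exists2 eta, 0 < eta & exists r0, forall (x : 'rV[R]_n) r, r0 <= r ->
    card_le [set l | [/\ L l, small rho (lsubmx l),
        thickening_in V (boundary_in V W) eta (lsubmx l) & small r (rsubmx l - x)]]
      (C * e * r ^+ n).
Proof.
move=> rho0 C0 W_regular UU1 W_bounded C_count a e e0 V.
have [eta eta0 T_small] := regular_small_thickening a W_regular UU1 e0.
rewrite -/V in T_small; have eta2 : 0 < eta / 2 by apply: divr_gt0.
exists (eta / 2) => //.
pose B := frame a U @^-1` thickening_in V (boundary_in V W) (eta / 2).
have BT : closure B `<=` frame a U @^-1` thickening_in V (boundary_in V W) eta.
  move=> t /(_ (ball t (eta / 2 / entry_sum U))).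
  case=> [|t' [[_ [z Vz /ball_small[_ t'z]]] /ball_small[_ tt']]].
    by apply: nbhsx_ballx; rewrite divr_gt0 ?entry_sum_gt0.
  split; first by exists t.
  exists z => //; apply/ball_small; split=> //.
  have -> : frame a U t - z = (frame a U t' - z) - (t' - t) *m U.
    rewrite /frame mulmxBl; apply/rowP => i; rewrite !mxE; ring.
  rewrite [eta]splitr; apply: smallB => //.
  have -> : eta / 2 = eta / 2 / entry_sum U * entry_sum U.
    by rewrite divfK // lt0r_neq0 // entry_sum_gt0.
  by apply: small_mulmx => //; rewrite divr_gt0 ?entry_sum_gt0.
have [c c0 a_c] := small_exists a.
have compactB : compact (closure B).
  apply: (@compact_closure_bounded _ _ _ ((rho + eta / 2 + c) * entry_sum U^T)).
    by rewrite mulr_gt0 ?entry_sum_gt0 // !addr_gt0.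
  move=> t [_ [z Vz /ball_small[_ tz]]].
  (* As the rows of [U] are orthonormal, [U^T] recovers the coordinates [t] from a point close to
     the bounded boundary. *)
  have -> : t = (z + (frame a U t - z) - a) *m U^T.
    by rewrite subrKC /frame addrAC subrr add0r -mulmxA UU1 mulmx1.
  apply: small_mulmx; first by rewrite !addr_gt0.
  by apply: smallB => //; apply: smallD => //; apply: W_bounded Vz.
have [boxes [boxes_nd boxesB boxes_e]] := compact_box_cover T_small compactB BT.
have [r0 r0P] := @seq_common_threshold _ boxes (fun p r => forall x : 'rV[R]_n,
      card_le [set l | [/\ L l, small rho (lsubmx l),
          exists2 t, box p t & lsubmx l = a + t *m U & small r (rsubmx l - x)]]
        (C * box_volume p * r ^+ n))
  (fun p p_boxes => let: ex_intro b bP := C_count a p (boxes_nd p p_boxes) in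
     ex_intro _ b (fun r br x => bP x r br)).
exists (Num.max 0 r0) => x r; rewrite ge_max => /andP[r_ge0 r_ger0].
apply: card_le_sub (card_le_bigcup (fun p p_boxes => r0P p p_boxes r r_ger0 x)).
- move=> l [Ll lrho Tl lr]; have [[t _ tl] _] := Tl.
  have /boxesB[p p_boxes pt] : closure B t by apply: subset_closure; rewrite /B /= tl.
  by exists p => //; split=> //; exists t.
- rewrite -mulr_suml -mulr_sumr; apply: ler_wpM2r; first exact: exprn_ge0.
  by rewrite ler_pM2l // ltW.
Qed.

(* For eta small, p_1 l and p_1 l' lie in one coset of the span of the short
   vectors of p_1(L), and the segment joining them meets the boundary of W in that
   coset; as the boundary is bounded, only finitely many cosets occur. *)
Lemma boundary_count m n (L : set 'rV[R]_(m + n)) (W : set 'rV[R]_m) :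
  is_lattice L -> regular_window W -> forall eps : R, 0 < eps ->
  exists2 eta, 0 < eta & exists2 r0, 0 < r0 & forall (x : 'rV[R]_n) r, r0 <= r ->
    card_le [set l | [/\ L l,
        exists l', [/\ L l', small eta (lsubmx (l' - l)) &
          ~ (W (lsubmx l) <-> W (lsubmx l'))] & small r (rsubmx l - x)]]
      (eps * r ^+ n).
Proof.
move=> L_lattice W_regular eps eps0.
have [rho1 rho10 W_bounded] := regular_boundary_bounded W_regular.
have [k [U [delta [delta0 UU1 L_delta U_dense]]]] := dense_directions L_lattice.
have rho0 : 0 < rho1 + 1 by apply: addr_gt0.
have [C C0 C_count] := box_strip_count L_lattice UU1 U_dense rho0.
(* Finitely many base points for the cosets: a lattice point within [delta] of [u] under p_1 lies in
   the coset of [u]. *)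
have [s [sA s_net]] := @small_net _ _ _ lsubmx
  [set l | L l /\ small (rho1 + 1) (lsubmx l)] (rho1 + 1) _ delta0 (fun l => @proj2 _ _).
(* An equal share of [eps] for each base point; the successor avoids a division by 0 when there are
   none. *)
have e0 : 0 < eps / (C * (size s).+1%:R) by rewrite divr_gt0 ?mulr_gt0 ?ltr0n.
have W_bounded' V z : boundary_in V W z -> small (rho1 + 1) z.
  by move=> /W_bounded; apply: small_le; rewrite lerDl.
have /choice[etaf etafP] : forall u : 'rV[R]_(m + n), exists eta, 0 < eta /\
    exists r0, forall r, r0 <= r -> forall (x : 'rV[R]_n),
    card_le [set l | [/\ L l, small (rho1 + 1) (lsubmx l),
        let V := affine_subspace (lsubmx u) U in
        thickening_in V (boundary_in V W) eta (lsubmx l) & small r (rsubmx l - x)]]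
      (C * (eps / (C * (size s).+1%:R)) * r ^+ n).
  move=> u; have [eta eta0 [r0 r0P]] := @coset_boundary_count _ _ _ _ _ _ _ _
    rho0 C0 W_regular UU1 W_bounded' C_count (lsubmx u) _ e0.
  by exists eta; split=> //; exists r0 => r rr0 x; apply: r0P.
have [r0 r0P] := @seq_common_threshold _ s _ (fun u _ => (etafP u).2).
have [eta1 eta10 eta1P] := @seq_lower_bound _ _ s etaf (fun u _ => (etafP u).1).
(* [eta1] suits the thickenings in all cosets, 1 keeps p_1(l) within [rho1 + 1], and [delta] puts
   p_1(l' - l) in the span of [U]. *)
pose eta := Num.min eta1 (Num.min 1 delta).
have eta0 : 0 < eta by rewrite !lt_min eta10 ltr01.
exists eta => //; exists (Num.max 1 r0); first by rewrite lt_max ltr01.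
move=> x r; rewrite ge_max => /andP[r_ge1 r_ger0].
apply: card_le_sub (card_le_bigcup (fun u us => r0P u us r r_ger0 x)); last first.
  rewrite big_const_seq count_predT iter_addr_0 -mulrnAl; apply: ler_wpM2r.
    by apply: exprn_ge0; lra.
  rewrite -mulr_natr.
  have cancelC N M : N != 0 -> C * (eps / (C * N)) * M = eps * (M / N).
    by move=> N0; field; rewrite N0 lt0r_neq0.
  rewrite cancelC ?pnatr_eq0 //.
  rewrite -[leRHS]mulr1 ler_pM2l // ler_pdivrMr ?ltr0n // mul1r ler_nat.
  exact: leqnSn.
move=> l [Ll [l' [Ll' ll' Wll']] lr].
have [t tE] : exists t, lsubmx (l' - l) = t *m U.
  apply: L_delta; first exact: latticeB.
  by apply: small_le ll'; rewrite !ge_min lexx !orbT.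
have l'E : lsubmx l' = lsubmx l + t *m U by rewrite -tE raddfB /= subrKC.
rewrite tE in ll'.
(* Used for two presentations of the same coset: based at [l], to bound p_1(l) and so find [u] in
   the net; then based at [u], where the count is available. *)
have cross V : (forall c, V (lsubmx l + c *: (t *m U))) ->
    exists2 z, boundary_in V W z & small eta (lsubmx l - z).
  move=> VU; have [Wl|nWl] := pselect (W (lsubmx l)).
    have nWl' : ~ W (lsubmx l') by move=> Wl'; apply: Wll'.
    have [c _||z [Vz zl _]] := @boundary_crossing _ _ V _ _ _ eta _ Wl nWl' eta0.
    - by rewrite l'E addrAC subrr add0r.
    - by rewrite l'E addrAC subrr add0r.
    - by exists z => //; rewrite -opprB; apply: smallN.
  have Wl' : W (lsubmx l') by apply: contrapT => nWl'; apply: Wll'; split.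
  have [c _||z [Vz _ zl]] := @boundary_crossing _ _ V _ _ _ eta _ Wl' nWl eta0.
  - have -> : lsubmx l' + c *: (lsubmx l - lsubmx l') =
        lsubmx l + (1 - c) *: (t *m U); last exact: VU.
      by rewrite l'E opprD addrA subrr add0r scalerN scalerBl scale1r addrA.
  - by rewrite l'E opprD addrA subrr add0r; apply: smallN.
  - by exists z => //; rewrite -opprB; apply: smallN.
have lrho : small (rho1 + 1) (lsubmx l).
  have [c|z /W_bounded zrho zl] := cross (affine_subspace (lsubmx l) U).
    by exists (c *: t) => //; rewrite /frame scalemxAl.
  rewrite -(subrKC z (lsubmx l)); apply: smallD => //.
  by apply: small_le zl; rewrite !ge_min lexx !orbT.
have [u us lu] := s_net l (conj Ll lrho); exists u => //; split=> //.
have [[Lu _] Lul] := (sA u us, latticeB L_lattice Ll (sA u us).1).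
have [t' t'E] : exists t', lsubmx (l - u) = t' *m U.
  by apply: L_delta => //; rewrite raddfB.
have lE : lsubmx l = lsubmx u + t' *m U by rewrite -t'E raddfB /= subrKC.
have [c|z Vz zl] := cross (affine_subspace (lsubmx u) U).
  by exists (t' + c *: t) => //; rewrite /frame mulmxDl -scalemxAl lE addrA.
split; first by exists t'.
exists z => //; apply/ball_small; have [etau0 _] := etafP u; split=> //.
by apply: small_le zl; rewrite ge_min eta1P.
Qed.

End BoundaryCount.

(** * Measurability of countable windows *)

Section CountableWindows.
Context {R : realType}.

Lemma lebesgue_ge0 k (A : set 'rV[R]_k) : (0 <= lebesgue A)%E.
Proof.
apply: le_ereal_inf_tmp => _ [D [_ Dle _] <-]; apply: esum_ge0 => p /Dle p12.
by rewrite lee_fin; apply: box_volume_ge0.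
Qed.

Lemma le_lebesgue k (A B : set 'rV[R]_k) : A `<=` B -> (lebesgue A <= lebesgue B)%E.
Proof.
move=> AB; apply: le_ereal_inf_tmp => _ [D [cD Dle BD] <-].
by apply: ereal_inf_lbound; exists D => //; split=> //; apply: subset_trans BD.
Qed.

(* A countable set is covered by degenerate boxes, which have volume 0. *)
Lemma countable_lebesgue_measurable k (A : set 'rV[R]_k) :
  (0 < k)%N -> countable A -> lebesgue_measurable A.
Proof.
move=> k0 cA X.
pose E := [set (a, a) | a in A].
have E_vol p : E p -> (box_volume p)%:E = 0%E.
  move=> [a _ <-]; rewrite /box_volume (bigD1 (Ordinal k0)) //=.
  by rewrite subrr mul0r.
have cE : countable E by apply: card_le_trans (card_image_le _ _) _.
have E_le p : E p -> forall i, p.1 0 i <= p.2 0 i by move=> [a _ <-] i /=.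
have E_cover x : A x -> exists2 p, E p & box p x.
  by move=> Ax; exists (x, x); [exists x|move=> i /=; rewrite lexx].
have -> : lebesgue (X `&` A) = 0%E.
  apply/eqP; rewrite eq_le lebesgue_ge0 andbT; apply: ereal_inf_lbound.
  exists E; last exact: esum1.
  by split=> // x [_ /E_cover[p]]; exists p.
rewrite add0e; apply/eqP; rewrite eq_le; apply/andP; split; last first.
  by apply: le_lebesgue => x [].
apply: le_ereal_inf_tmp => _ [D [cD Dle XD] <-].
have vol0 p : (D `|` E) p -> (0 <= (box_volume p)%:E)%E.
  by move=> [/Dle|/E_le] p12; rewrite lee_fin; apply: box_volume_ge0.
have -> : \esum_(p in D) (box_volume p)%:E = \esum_(p in D `|` E) (box_volume p)%:E.
  rewrite (esumID D _ _ vol0) (setIidr (@subsetUl _ D E)).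
  by rewrite [X in (_ + X)%E]esum1 ?adde0 // => p [[Dp|/E_vol//]].
apply: ereal_inf_lbound; exists (D `|` E) => //; split.
- by rewrite -bigcup2E; apply: bigcup_countable => // -[|[|i]] _ //=; apply: countable0.
- by move=> p [/Dle|/E_le].
- move=> x Xx; have [/E_cover[p Ep px]|nAx] := pselect (A x).
    by exists p => //; right.
  by have [p Dp px] := XD x (conj Xx nAx); exists p => //; left.
Qed.

End CountableWindows.

(** * Almost periods from short lattice vectors; the Delone property *)

Section AlmostPeriods.
Context {R : realType}.

(* Cut down to p_1(L), so that its measurability is that of a countable set. *)
Definition short_window m n (L : set 'rV[R]_(m + n)) (eta : R) : set 'rV[R]_m :=
  [set p | small eta p /\ (lsubmx @` L) p].

Lemma short_model_setE m n (L : set 'rV[R]_(m + n)) eta :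
  model_set L (short_window L eta) =
  [set rsubmx l | l in [set l | L l /\ small eta (lsubmx l)]].
Proof.
apply/seteqP; split=> y [l [Ll lW] <-]; exists l => //; split=> //.
by case: lW.
Qed.

Lemma short_is_model_set m n (L : set 'rV[R]_(m + n)) eta : (0 < m)%N ->
  is_lattice L -> is_model_set (model_set L (short_window L eta)).
Proof.
move=> m0 L_lattice; exists m, L, (short_window L eta); split=> //.
apply: countable_lebesgue_measurable => //.
apply: (@sub_countable _ _ _ (lsubmx @` L)).
  by apply: subset_card_le => p [].
apply: card_le_trans (card_image_le _ _) _; have [B _ ->] := L_lattice.
by apply: card_le_trans (card_image_le _ _) _; apply: countableP.
Qed.

(** A lattice point near [(0, x)] has bounded p_1; subtracting a net vector with nearly the same p_1
    makes p_1 short and displaces p_2 by less than [r1], uniformly in [x]. *)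
Lemma short_relatively_dense m n (L : set 'rV[R]_(m + n)) eta : 0 < eta ->
  is_lattice L -> relatively_dense (model_set L (short_window L eta)).
Proof.
move=> eta0 L_lattice; rewrite short_model_setE.
have [C C0 L_C] := lattice_covering L_lattice.
have [s [sA s_net]] := @small_net _ _ _ lsubmx
  [set l | L l /\ small C (lsubmx l)] C _ eta0 (fun l => @proj2 _ _).
have [r1 r10 s_r1] := small_seq_bounded [seq rsubmx u | u <- s].
exists (C + r1); first exact: addr_gt0.
move=> x r rr; have [l Ll lx] := L_C (row_mx 0 x).
have l1 : small C (lsubmx l).
  have -> : lsubmx l = - lsubmx (row_mx 0 x - l).
    by rewrite raddfB /= row_mxKl sub0r opprK.
  by apply: smallN => i; rewrite mxE.
have l2 : small C (rsubmx l - x).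
  have -> : rsubmx l - x = - rsubmx (row_mx 0 x - l).
    by rewrite raddfB /= row_mxKr opprB.
  by apply: smallN => i; rewrite mxE.
have [u us lu] := s_net l (conj Ll l1); have [Lu _] := sA u us.
exists (rsubmx (l - u)); split.
  apply/ball_small; split; first by apply: lt_le_trans rr; apply: addr_gt0.
  rewrite raddfB /= addrAC; apply: (small_le rr); apply: smallB => //.
  by apply: s_r1; apply: map_f.
by exists (l - u) => //; split; [apply: latticeB|rewrite raddfB].
Qed.

Lemma short_almost_periods m n (L : set 'rV[R]_(m + n)) (W : set 'rV[R]_m) :
  is_lattice L -> regular_window W -> forall eps : R, 0 < eps ->
  exists2 eta, 0 < eta & exists2 r0, 0 < r0 &
    model_set L (short_window L eta) `<=`
      almost_periods_from (model_set L W) eps r0.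
Proof.
move=> L_lattice W_regular eps eps0.
(* The factor [2 ^+ n] matches the volume [(2 * r) ^+ n]; halving [eps] keeps the inequality strict
   after the supremum over centres. *)
have eps'0 : 0 < eps / 2 * 2 ^+ n by rewrite mulr_gt0 ?divr_gt0 ?exprn_gt0.
have [eta eta0 [r0 r00 count]] := boundary_count L_lattice W_regular eps'0.
exists eta => //; exists r0 => // v; rewrite short_model_setE => -[u [Lu ueta] <-] r r0r.
have r_gt0 : 0 < r by apply: lt_le_trans r0r.
apply: (@le_lt_trans _ _ (eps / 2)%:E); last by rewrite lte_fin; lra.
apply: ge_ereal_sup => _ [x _ <-].
set G := model_set L W; set S := _ `&` _.
have S_count : card_le S (eps / 2 * 2 ^+ n * r ^+ n).
  (* A point of G + v outside G lifts to [l + u] with partner [l], a point of G outside G + v to [l]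
     with partner [l - u]. Exactly one of the two has p_1 in [W], since absence from G or G + v
     excludes every lift. *)
  apply: (card_le_surj (f := rsubmx)) (count x r r0r) => y [yG /ball_small[_ yx]].
  case: yG => -[].
  - move=> [_ [l [Ll Wl] <-] yE] nGy.
    exists (l + u); last by rewrite raddfD.
    split; [exact: latticeD| |by rewrite raddfD /= yE].
    exists l; split=> //; first by rewrite opprD addrA subrr add0r raddfN; apply: smallN.
    move=> [_ /(_ Wl) Wlu]; apply: nGy; exists (l + u); last by rewrite raddfD.
    by split=> //; apply: latticeD.
  - move=> [l [Ll Wl] yE] nGy; exists l => //; split=> //; last by rewrite yE.
    exists (l - u); split; first exact: latticeB.
      by rewrite addrAC subrr add0r raddfN; apply: smallN.
    move=> [/(_ Wl) Wlu _]; apply: nGy; exists (rsubmx (l - u)).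
      by exists (l - u) => //; split=> //; apply: latticeB.
    by rewrite raddfB /= subrK.
apply: (@le_trans _ _ ((eps / 2 * 2 ^+ n * r ^+ n)%:E * (((2 * r) ^+ n)^-1)%:E)%E).
  apply: lee_wpmul2r; last exact: counting_card_le.
  by rewrite lee_fin invr_ge0 exprn_ge0 // mulr_ge0 // ltW.
rewrite -EFinM lee_fin exprMn -mulrA -mulrA mulrA mulfK //.
by rewrite -exprMn lt0r_neq0 // exprn_gt0 // mulr_gt0.
Qed.

Lemma sub_relatively_dense n (A B : set 'rV[R]_n) : A `<=` B ->
  relatively_dense A -> relatively_dense B.
Proof.
move=> AB [r0 r00 A_r0]; exists r0 => // x r /A_r0-/(_ x)[y [xy Ay]].
by exists y; split=> //; apply: AB.
Qed.

(** Adding short lattice vectors to one lattice point whose p_1 is interior to [W] stays in the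
    window, so the model set contains a translate of a short one. *)
Lemma model_set_relatively_dense m n (L : set 'rV[R]_(m + n)) (W : set 'rV[R]_m) :
  is_lattice L -> interior W `&` (lsubmx @` L) !=set0 ->
  relatively_dense (model_set L W).
Proof.
move=> L_lattice [p0 [/nbhs_ballP[eta /= eta0 W_eta] [l0 Ll0 l0E]]].
have [r0 r00 M_r0] := short_relatively_dense eta0 L_lattice.
exists r0 => // x r r0r; have [y []] := M_r0 (x - rsubmx l0) r r0r.
move=> /ball_small[r_gt0 yx]; rewrite short_model_setE => -[l [Ll leta] lE].
exists (rsubmx (l + l0)); split.
  apply/ball_small; split=> //; rewrite raddfD /= lE.
  by rewrite opprB addrA in yx.
exists (l + l0) => //; split; first exact: latticeD.
by apply: W_eta; apply/ball_small; rewrite -l0E raddfD /= addrK.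
Qed.

Lemma bounded_set_small k (A : set 'rV[R]_k) : bounded_set A ->
  exists2 rho, 0 < rho & forall x, A x -> small rho x.
Proof.
move=> [M [_ AM]]; pose b := Num.max (M + 1) 1.
have b_gt0 : 0 < b + 1 by rewrite ltr_wpDl // le_max ler01 orbT.
exists (b + 1) => // x Ax i; apply: (@le_lt_trans _ _ b); last by rewrite ltrDl.
have /AM/(_ x Ax) : M < b by rewrite lt_max ltrDl ltr01.
apply: le_trans; rewrite /Num.norm /= mx_normrE.
exact: (le_bigmax _ (fun ij => `|x ij.1 ij.2|) (0, i)).
Qed.

Lemma not_small k (x : 'rV[R]_k) : exists h, 0 < h /\ (x != 0 -> ~ small h x).
Proof.
have [->|x0] := eqVneq x 0; first by exists 1.
have [i xi] : exists i, x 0 i != 0.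
  apply: contrapT => nx; case/eqP: x0; apply/rowP => i; rewrite mxE.
  by apply: contrapT => xi; apply: nx; exists i; apply/eqP.
exists `|x 0 i|; split=> [|_ /(_ i)]; first by rewrite normr_gt0.
by rewrite ltxx.
Qed.

(** Differences of points over [W] lie over a bounded set, and only finitely many lattice points
    there have p_2 in the unit ball; [h] lies below the size of every nonzero p_2 among them. Two
    points in a ball of radius [r0] differ by less than [2 * r0 = Num.min 1 h]. *)
Lemma model_set_uniformly_discrete m n (L : set 'rV[R]_(m + n)) (W : set 'rV[R]_m) :
  is_lattice L -> bounded_set W -> uniformly_discrete (model_set L W).
Proof.
move=> L_lattice /bounded_set_small[rho rho0 W_rho].
have [C C0 count] := strip_count L_lattice (addr_gt0 rho0 rho0).
have /finite_seqP[s sE] := card_le_finite (count 0 1 (lexx 1)).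
have /choice[hf hfP] := @not_small n.
have [h h0 h_s] := @seq_lower_bound _ _ s (fun l => hf (rsubmx l))
  (fun l _ => (hfP (rsubmx l)).1).
pose r0 := Num.min 1 h / 2.
have r00 : 0 < r0 by rewrite divr_gt0 // lt_min ltr01.
exists r0 => // x r /andP[r_gt0 rr0] y z.
move=> [/ball_small[_ yx] [l [Ll Wl] lE]] [/ball_small[_ zx] [l' [Ll' Wl'] l'E]].
apply: contrapT => yz.
have yz_small : small (Num.min 1 h) (rsubmx (l - l')).
  rewrite raddfB /= lE l'E.
  have -> : y - z = (y - x) - (z - x) by rewrite opprB addrA subrK.
  by apply: (@small_le _ _ (r + r)); [rewrite /r0 in rr0; lra|apply: smallB].
have ls : l - l' \in s.
  suff : [set` s] (l - l') by [].
  rewrite -sE; split; first exact: latticeB.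
    by rewrite raddfB; apply: smallB; apply: W_rho.
  by rewrite subr0; apply: small_le yz_small; rewrite ge_min lexx.
have [_ hl] := hfP (rsubmx (l - l')); apply: hl.
  by rewrite raddfB /= lE l'E subr_eq0; apply/eqP.
by apply: small_le yz_small; rewrite ge_min h_s ?orbT.
Qed.

Lemma delone_almost_periodic_pattern m n (L : set 'rV[R]_(m + n)) (W : set 'rV[R]_m) :
  is_lattice L -> regular_window W -> delone (model_set L W) ->
  almost_periodic_pattern (model_set L W).
Proof.
move=> L_lattice W_regular G_delone; split=> // eps eps0.
have [eta eta0 [r0 r00 M_periods]] := short_almost_periods L_lattice W_regular eps0.
exists r0 => //; apply: sub_relatively_dense M_periods _.
exact: short_relatively_dense.
Qed.

End AlmostPeriods.

Theorem theorem9 (R : realType) (m n : nat) (m_gt0 : (0 < m)%N)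
    (n_gt0 : (0 < n)%N) (L : set 'rV[R]_(m + n)) (W : set 'rV[R]_m)
    (L_lattice : is_lattice L) (W_measurable : lebesgue_measurable W)
    (W_regular : regular_window W) (G : set 'rV[R]_n)
    (G_def : G = model_set L W) :
  [/\ delone G -> almost_periodic_pattern G,
      bounded_set W -> interior W `&` (lsubmx @` L) !=set0 ->
        almost_periodic_pattern G,
      forall eps : R, 0 < eps ->
        exists M : set 'rV[R]_n,
          [/\ is_model_set M, relatively_dense M & M `<=` almost_periods G eps]
    & forall eps : R, 0 < eps ->
        exists2 r0 : R, 0 < r0 &
          exists M : set 'rV[R]_n,
            [/\ is_model_set M, relatively_dense M
              & M `<=` almost_periods_from G eps r0]].
Proof.
have periods eps : 0 < eps -> exists2 r0 : R, 0 < r0 & exists M : set 'rV[R]_n,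
    [/\ is_model_set M, relatively_dense M & M `<=` almost_periods_from G eps r0].
  move=> eps0; rewrite G_def.
  have [eta eta0 [r0 r00 M_periods]] := short_almost_periods L_lattice W_regular eps0.
  exists r0 => //; exists (model_set L (short_window L eta)); split=> //.
    exact: short_is_model_set.
  exact: short_relatively_dense.
split=> [|W_bounded W_int|eps /periods[r0 r00 [M [M_model M_dense M_periods]]]|//].
- by rewrite G_def; apply: delone_almost_periodic_pattern.
- rewrite G_def; apply: delone_almost_periodic_pattern => //; split.
    exact: model_set_relatively_dense.
  exact: model_set_uniformly_discrete.
- by exists M; split=> // v /M_periods; exists r0.
Qed.
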